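(* On the noncommutative torus $A=\mathbb{C}_\theta[\mathbb{T}^2]$ with a rank-two free spinor bimodule, Clifford matrices $C^i=\sigma^i$ ($i=1,2$) and $J=\sigma^1$ if $\epsilon=\epsilon'=1$, $J=\sigma^2$ if $\epsilon=\epsilon'=-1$ (up to a phase), geometric realisation at the local tensorial level without imposing covariance of the Clifford action leads, for each of the two sign choices, to a real 8-parameter moduli of spinor bimodule connections $\nabla_{\mathcal S}$, with a real 4-parameter submoduli of those that are compatible with $\gamma=\sigma^3$. The latter (those compatible with $\gamma$) result in Dirac operators of the form $({\not\!D}\psi)_\beta=((\partial_i+d_i)\psi_\alpha)\sigma^{i\,\alpha}{}_\beta$ with $d_i\in\mathbb{R}$, and the spectral triples obtained from them are those with $({\not\!D}\psi)_\beta=(\partial_i\psi_\alpha)\sigma^{i\,\alpha}{}_\beta$. More generally, from the full moduli one obtains a 1-parameter moduli of spectral triples with real parameter $m$: $$\epsilon=\epsilon'=1:\quad {\not\!D}\psi=\partial_i\psi\,\sigma^i+\imath m\,\psi\,\sigma^3;\qquad \epsilon=\epsilon'=-1:\quad {\not\!D}\psi=\partial_i\psi\,\sigma^i+\imath m\,\psi .$$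
   Context: **Torus.** $A=\mathbb{C}_\theta[\mathbb{T}^2]$ is the $*$-algebra generated by unitaries $u,v$ with $vu=e^{\imath\theta}uv$, $\theta\in\mathbb{R}$ with $\theta/2\pi$ irrational (so the centre is $\mathbb{C}1$). $\Omega^1$ has relations $(du)u=u\,du$, $(dv)v=v\,dv$, $(dv)u=e^{\imath\theta}u\,dv$, $(du)v=e^{-\imath\theta}v\,du$. The forms $s^1=-\imath u^{-1}du$, $s^2=-\imath v^{-1}dv$ are a central self-adjoint basis of $\Omega^1$. Partial derivatives are defined by $da=(\partial_i a)s^i$, so $\partial_1(u^mv^n)=\imath m\,u^mv^n$, $\partial_2(u^mv^n)=\imath n\,u^mv^n$. The metric is $g=s^1\otimes s^1+s^2\otimes s^2$. **Spinor data.** $\mathcal S$ is free over $A$ with central basis $e^1,e^2$. A bimodule connection $\nabla_{\mathcal S}e^\alpha=S^\alpha{}_{i\beta}s^i\otimes e^\beta$ obeys $\nabla_{\mathcal S}(a\psi)=a\nabla_{\mathcal S}\psi+da\otimes\psi$, $\nabla_{\mathcal S}(\psi a)=(\nabla_{\mathcal S}\psi)a+\sigma_{\mathcal S}(\psi\otimes da)$ for a bimodule map $\sigma_{\mathcal S}$; on this algebra necessarily $\sigma_{\mathcal S}$ is the flip on bases and $S^\alpha{}_{i\beta}\in\mathbb{C}$. The Clifford action is $s^i\triangleright e^\alpha=C^{i\alpha}{}_\beta e^\beta$, here $C^i=\sigma^i$. Charge conjugation is $\mathcal J(ae^\alpha)=a^*J^\alpha{}_\beta e^\beta$ and the even structure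 is $\gamma(e^\alpha)=\gamma^\alpha{}_\beta e^\beta$. Matrices $C^i,S_i,J,\gamma$ have row index $\alpha$, column index $\beta$, and overline is entrywise complex conjugation. The Dirac operator is $({\not\!D}\psi)_\gamma=(\partial_i\psi_\alpha+\psi_\beta S^\beta{}_{i\alpha})C^{i\alpha}{}_\gamma$ for $\psi=\psi_\alpha e^\alpha$; $\psi\sigma^i$ denotes the spinor with components $(\psi\sigma^i)_\beta=\psi_\alpha\sigma^{i\,\alpha}{}_\beta$. **Conditions.** With $C^i=\sigma^i$ ($i=1,2$) and $J=\sigma^1$ if $\epsilon=\epsilon'=1$, $J=\sigma^2$ if $\epsilon=\epsilon'=-1$, up to a phase (which satisfy $\overline JJ=\epsilon\,\mathrm{id}$, $\overline{C^i}J=\epsilon'JC^i$ and the Clifford relations $C^iC^j+C^jC^i=2\delta^{ij}\mathrm{id}$), the local tensorial level without covariance of $\triangleright$ requires of $\nabla_{\mathcal S}$ only the reality condition $\overline{S_i}J=JS_i$. Covariance of $\triangleright$, which is not imposed, would be $[C^i,S_j]=-\frac12\Gamma^i{}_{jk}C^k$ for a connection $\nabla s^i=-\frac12\Gamma^i{}_{jk}s^j\otimes s^k$ on $\Omega^1$. Compatibility of $\nabla_{\mathcal S}$ with $\gamma$ means $[S_i,\gamma]=0$. The data gives a spectral triple (with hermitian Dirac operator $\imath{\not\!D}$) when moreover ${\not\!D}$ is antihermitian, and $\mathcal J$ an antilinear isometry, for $\langle\phi_\alpha e^\alpha,\psi_\beta e^\beta\rangle=\int\phi_\alpha^*\psi_\alpha$,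 where $\int u^mv^n=\delta_{m,0}\delta_{n,0}$; if $\gamma$ is included it must be hermitian and compatible with $\nabla_{\mathcal S}$. Pauli matrices: $\sigma^1=\begin{pmatrix}0&1\\1&0\end{pmatrix}$, $\sigma^2=\begin{pmatrix}0&-\imath\\\imath&0\end{pmatrix}$, $\sigma^3=\begin{pmatrix}1&0\\0&-1\end{pmatrix}$. *)

(* Defs.v *)
From HB Require Import structures.
From mathcomp Require Import all_boot all_order all_algebra.
From mathcomp Require Import complex.
From mathcomp Require Import reals trigo.
From mathcomp Require Import finmap monalg.
From mathcomp Require Import ring.

Set Implicit Arguments.
Unset Strict Implicit.
Unset Printing Implicit Defensive.

Import Order.TTheory GRing.Theory Num.Theory.
Local Open Scope ring_scope.

(** Complex numbers of modulus 1. The algebra is built over any number field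
    closed under complex conjugation; the torus C_theta[T^2] is [nctorus] at
    [expi theta : phase R[i]]. *)
Record phase (C : numClosedFieldType) := Phase {
  phase_val : C ;
  phase_norm : `|phase_val| = 1 }.

(** [Word m n] stands for the basis element u^m v^n. *)
Record word := Word { u_exp : int ; v_exp : int }.

Definition pair_of_word w := (u_exp w, v_exp w).
Definition word_of_pair p := Word p.1 p.2.
Lemma pair_of_wordK : cancel pair_of_word word_of_pair. Proof. by case. Qed.
HB.instance Definition _ := Choice.copy word (can_type pair_of_wordK).

Definition nctorus (C : numClosedFieldType) (q : phase C) : Type :=
  {malg C[word]}.

HB.instance Definition _ (C : numClosedFieldType) (q : phase C) :=
  GRing.Lmodule.on (nctorus q).

(** (u^m v^n) (u^p v^r) = q^(n p) u^(m+p) v^(n+r), because v u = q u v. *)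
HB.lock Definition nct_mul (C : numClosedFieldType) (q : phase C) (f g : nctorus q) :
    nctorus q :=
  \sum_(k <- msupp f) \sum_(l <- msupp g)
    << f@_k * g@_l * phase_val q ^ (v_exp k * u_exp l) *g Word (u_exp k + u_exp l) (v_exp k + v_exp l) >>.

(** (u^m v^n)^* = v^(-n) u^(-m) = q^(m n) u^(-m) v^(-n). *)
Definition nct_star (C : numClosedFieldType) (q : phase C) (f : nctorus q) :
    nctorus q :=
  \sum_(k <- msupp f)
    << (f@_k)^* * phase_val q ^ (u_exp k * v_exp k) *g Word (- u_exp k) (- v_exp k) >>.

Section NCTorusAlgebra.
Context (C : numClosedFieldType) (q : phase C).
Local Notation A := (nctorus q).
Implicit Types (f g h : A) (k l : word).

Lemma conj_phase_mul : (phase_val q)^* * phase_val q = 1.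
Proof. by rewrite mulrC -normCK phase_norm expr1n. Qed.

Lemma phase_neq0 : phase_val q != 0.
Proof. by rewrite -normr_eq0 phase_norm oner_eq0. Qed.

Lemma conj_phaseX (m : int) : (phase_val q ^ m)^* = phase_val q ^ (- m).
Proof.
have qV : (phase_val q)^* = (phase_val q)^-1.
  by apply: (mulIf phase_neq0); rewrite conj_phase_mul mulVf ?phase_neq0.
by rewrite -exprz_inv -qV; case: m => n; rewrite /exprz ?fmorphV/= rmorphXn.
Qed.

Let term f g k l : A :=
  << f@_k * g@_l * phase_val q ^ (v_exp k * u_exp l) *g Word (u_exp k + u_exp l) (v_exp k + v_exp l) >>.

Lemma nct_mulEw (E F : {fset word}) f g :
  (msupp f `<=` E)%fset -> (msupp g `<=` F)%fset ->
  nct_mul f g = \sum_(k <- E) \sum_(l <- F) term f g k l.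
Proof.
move=> fE gF; rewrite nct_mul.unlock (big_fset_incl _ fE) /=; last first.
  move=> k _ /mcoeff_outdom fk; rewrite big1 // => l _.
  by rewrite fk !mul0r monalgU0.
apply: eq_bigr => k _; apply: big_fset_incl => // l _ /mcoeff_outdom gl.
by rewrite gl mulr0 mul0r monalgU0.
Qed.

Lemma nct_mulUU (a b : C) k l :
  nct_mul (<< a *g k >> : A) (<< b *g l >> : A) =
  << a * b * phase_val q ^ (v_exp k * u_exp l) *g Word (u_exp k + u_exp l) (v_exp k + v_exp l) >>.
Proof.
by rewrite (nct_mulEw msuppU_le msuppU_le) !big_seq_fset1 /term !mcoeffUU.
Qed.

Lemma nct_mulDl : left_distributive (@nct_mul C q) +%R.
Proof.
move=> f g h.
rewrite (nct_mulEw (msuppD_le f g) (fsubset_refl _)).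
rewrite (nct_mulEw (fsubsetUl _ (msupp g)) (fsubset_refl (msupp h))).
rewrite (nct_mulEw (fsubsetUr (msupp f) _) (fsubset_refl (msupp h))).
rewrite -big_split /=; apply: eq_bigr => k _.
rewrite -big_split /=; apply: eq_bigr => l _.
by rewrite /term mcoeffD !mulrDl monalgUD.
Qed.

Lemma nct_mulDr : right_distributive (@nct_mul C q) +%R.
Proof.
move=> h f g.
rewrite (nct_mulEw (fsubset_refl _) (msuppD_le f g)).
rewrite (nct_mulEw (fsubset_refl (msupp h)) (fsubsetUl _ (msupp g))).
rewrite (nct_mulEw (fsubset_refl (msupp h)) (fsubsetUr (msupp f) _)).
rewrite -big_split /=; apply: eq_bigr => k _.
rewrite -big_split /=; apply: eq_bigr => l _.
by rewrite /term mcoeffD mulrDr mulrDl monalgUD.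
Qed.

Lemma nct_mul0l : left_zero 0 (@nct_mul C q).
Proof. by move=> f; rewrite nct_mul.unlock msupp0 big_seq_fset0. Qed.

Lemma nct_mul0r : right_zero 0 (@nct_mul C q).
Proof.
by move=> f; rewrite nct_mul.unlock big1 // => k _; rewrite msupp0 big_seq_fset0.
Qed.

Lemma nct_mul_suml (I : Type) (s : seq I) (F : I -> A) g :
  nct_mul (\sum_(i <- s) F i) g = \sum_(i <- s) nct_mul (F i) g.
Proof.
exact: (big_morph (fun f => nct_mul f g) (fun _ _ => nct_mulDl _ _ _)
  (nct_mul0l _)).
Qed.

Lemma nct_mul_sumr (I : Type) (s : seq I) (F : I -> A) f :
  nct_mul f (\sum_(i <- s) F i) = \sum_(i <- s) nct_mul f (F i).
Proof.
exact: (big_morph (nct_mul f) (fun _ _ => nct_mulDr _ _ _) (nct_mul0r _)).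
Qed.

Lemma nct_mulA : associative (@nct_mul C q).
Proof.
move=> f g h.
transitivity (\sum_(k <- msupp f) \sum_(l <- msupp g) \sum_(m <- msupp h)
  nct_mul (<< f@_k *g k >> : A) (nct_mul << g@_l *g l >> << h@_m *g m >>)).
  rewrite {1}[f]monalgE nct_mul_suml; apply: eq_bigr => k _.
  rewrite {1}[g]monalgE nct_mul_suml nct_mul_sumr; apply: eq_bigr => l _.
  rewrite {1}[h]monalgE (nct_mul_sumr _ _ << g@_l *g l >>).
  exact: (nct_mul_sumr _ _ << f@_k *g k >>).
rewrite [f in RHS]monalgE (nct_mul_suml _ _ g) (nct_mul_suml _ _ h); apply: eq_bigr => k _.
rewrite [g in RHS]monalgE (nct_mul_sumr _ _ << f@_k *g k >>) (nct_mul_suml _ _ h); apply: eq_bigr => l _.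
rewrite [h in RHS]monalgE (nct_mul_sumr (msupp h)); apply: eq_bigr => m _.
rewrite !nct_mulUU /= !addrA; congr (<< _ *g _ >>).
rewrite mulrDr mulrDl !(expfzDr _ _ phase_neq0).
set x := phase_val q ^ (v_exp l * u_exp m); set y := phase_val q ^ (v_exp k * u_exp l); set z := phase_val q ^ (v_exp k * u_exp m).
ring.
Qed.

Definition nct_one : A := << 1 *g Word 0 0 >>.

Lemma nct_mul1l : left_id nct_one (@nct_mul C q).
Proof.
move=> f; rewrite [f in LHS]monalgE nct_mul_sumr [RHS]monalgE.
apply: eq_bigr => -[m n] _.
by rewrite nct_mulUU /= mul0r expr0z mulr1 mul1r !add0r.
Qed.

Lemma nct_mul1r : right_id nct_one (@nct_mul C q).
Proof.
move=> f; rewrite [f in LHS]monalgE nct_mul_suml [RHS]monalgE.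
apply: eq_bigr => -[m n] _.
by rewrite nct_mulUU /= mulr0 expr0z !mulr1 !addr0.
Qed.

Lemma nct_one_neq0 : nct_one != 0.
Proof. by rewrite monalgU_eq0 oner_eq0. Qed.

HB.instance Definition _ := GRing.Zmodule_isNzRing.Build A
  nct_mulA nct_mul1l nct_mul1r nct_mulDl nct_mulDr nct_one_neq0.

Lemma nct_mulE f g : f * g = nct_mul f g. Proof. by []. Qed.

Lemma nct_scaleU (c a : C) k : c *: (<< a *g k >> : A) = << c * a *g k >>.
Proof.
apply/malgP => l.
rewrite mcoeffZ.
rewrite mcoeffU.
rewrite mcoeffU.
by rewrite mulrnAr.
Qed.

Lemma nct_scaleE (c : C) f :
  c *: f = \sum_(k <- msupp f) << c * f@_k *g k >>.
Proof.
by rewrite {1}[f]monalgE scaler_sumr; apply: eq_bigr => k _; rewrite nct_scaleU.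
Qed.

Lemma nct_mul_constl (c : C) f : (<< c *g Word 0 0 >> : A) * f = c *: f.
Proof.
rewrite nct_mulE (nct_mulEw msuppU_le (fsubset_refl _)) big_seq_fset1 nct_scaleE.
apply: eq_bigr => -[m n] _.
by rewrite /term mcoeffUU /= mul0r expr0z mulr1 !add0r.
Qed.

Lemma nct_mul_constr (c : C) f : f * (<< c *g Word 0 0 >> : A) = c *: f.
Proof.
rewrite nct_mulE (nct_mulEw (fsubset_refl _) msuppU_le) nct_scaleE.
apply: eq_bigr => -[m n] _; rewrite big_seq_fset1.
by rewrite /term mcoeffUU /= mulr0 expr0z mulr1 !addr0 mulrC.
Qed.

Lemma nct_scaleAl (c : C) f g : c *: (f * g) = (c *: f) * g.
Proof. by rewrite -!nct_mul_constl mulrA. Qed.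

Lemma nct_scaleAr (c : C) f g : c *: (f * g) = f * (c *: g).
Proof. by rewrite -!nct_mul_constr mulrA. Qed.

HB.instance Definition _ := GRing.Lmodule_isLalgebra.Build C A nct_scaleAl.
HB.instance Definition _ := GRing.Lalgebra_isAlgebra.Build C A nct_scaleAr.

Lemma nct_starEw (E : {fset word}) f : (msupp f `<=` E)%fset ->
  nct_star f = \sum_(k <- E)
    (<< (f@_k)^* * phase_val q ^ (u_exp k * v_exp k) *g Word (- u_exp k) (- v_exp k) >> : A).
Proof.
move=> fE; rewrite /nct_star (big_fset_incl _ fE) //= => k _ /mcoeff_outdom fk.
by rewrite fk conjC0 mul0r monalgU0.
Qed.

Lemma nct_starU (a : C) k :
  nct_star (<< a *g k >> : A) =
  << a^* * phase_val q ^ (u_exp k * v_exp k) *g Word (- u_exp k) (- v_exp k) >>.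
Proof. by rewrite (nct_starEw msuppU_le) big_seq_fset1 mcoeffUU. Qed.

Lemma nct_star0 : nct_star (0 : A) = 0.
Proof. by rewrite /nct_star msupp0 big_seq_fset0. Qed.

Lemma nct_starD f g : nct_star (f + g) = nct_star f + nct_star g.
Proof.
rewrite (nct_starEw (msuppD_le f g)).
rewrite (nct_starEw (fsubsetUl _ (msupp g))) (nct_starEw (fsubsetUr (msupp f) _)).
rewrite -big_split /=; apply: eq_bigr => k _.
by rewrite mcoeffD rmorphD mulrDl monalgUD.
Qed.

Lemma nct_star_sum (I : Type) (s : seq I) (F : I -> A) :
  nct_star (\sum_(i <- s) F i) = \sum_(i <- s) nct_star (F i).
Proof. exact: (big_morph _ nct_starD nct_star0). Qed.

Lemma nct_starK : involutive (@nct_star C q).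
Proof.
move=> f; rewrite {1}[f]monalgE (nct_star_sum (msupp f)) (nct_star_sum (msupp f)) [RHS]monalgE.
apply: eq_bigr => -[m n] _; rewrite !nct_starU /= !opprK mulrNN rmorphM /=.
by rewrite conjCK conj_phaseX -mulrA -expfzDr ?phase_neq0 // addNr expr0z mulr1.
Qed.

Lemma nct_starM f g : nct_star (f * g) = nct_star g * nct_star f.
Proof.
transitivity (\sum_(k <- msupp f) \sum_(l <- msupp g)
  nct_star ((<< f@_k *g k >> : A) * << g@_l *g l >>)).
  rewrite {1}[f]monalgE mulr_suml nct_star_sum; apply: eq_bigr => k _.
  by rewrite {1}[g]monalgE mulr_sumr nct_star_sum.
rewrite [f in RHS]monalgE (nct_star_sum (msupp f)) mulr_sumr.
apply: eq_bigr => k _.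
rewrite [g in RHS]monalgE (nct_star_sum (msupp g)) mulr_suml.
apply: eq_bigr => l _.
rewrite !nct_mulE nct_mulUU !nct_starU nct_mulUU /= !rmorphM /=.
rewrite conj_phaseX !opprD ![- u_exp k - _]addrC ![- v_exp k - _]addrC.
congr (<< _ *g _ >>).
rewrite -!mulrA mulrCA; congr (_ * _); rewrite [RHS]mulrCA; congr (_ * _).
rewrite -!expfzDr ?phase_neq0 //; congr (_ ^ _).
by rewrite mulrNN mulrDl !mulrDr; move: k l => [m n] [p r] /=; ring.
Qed.

End NCTorusAlgebra.

Section Generators.
Context (C : numClosedFieldType) (q : phase C).
Local Notation A := (nctorus q).

Definition nct_u : A := << 1 *g Word 1 0 >>.
Definition nct_v : A := << 1 *g Word 0 1 >>.

(** The presentation of the *-algebra: u and v are unitary, v u = q u v. *)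
Lemma nct_vu : nct_v * nct_u = (phase_val q) *: (nct_u * nct_v).
Proof.
rewrite !nct_mulE !nct_mulUU nct_scaleU /=.
by rewrite !(mulr1, mul1r, mulr0, mul0r, addr0, add0r, expr0z, expr1z).
Qed.

Lemma nct_u_unitary :
  nct_star nct_u * nct_u = 1 /\ nct_u * nct_star nct_u = 1.
Proof.
rewrite !nct_starU !nct_mulE !nct_mulUU /= conjC1.
by rewrite !(mulr1, mulr0, mul0r, oppr0, addr0, expr0z, addNr, subrr).
Qed.

Lemma nct_v_unitary :
  nct_star nct_v * nct_v = 1 /\ nct_v * nct_star nct_v = 1.
Proof.
rewrite !nct_starU !nct_mulE !nct_mulUU /= conjC1.
by rewrite !(mulr1, mulr0, mul0r, oppr0, addr0, expr0z, addNr, subrr).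
Qed.

End Generators.

Section Calculus.
Context (C : numClosedFieldType) (q : phase C).
Local Notation A := (nctorus q).

(** The left/right coefficients of a form in the central basis s^1, s^2 are its
    entries, so Omega^1 is ['rV[A]_2]: [*:] is the left action of A and [ract]
    the right one. *)
Definition ract m n (X : 'M[A]_(m, n)) (a : A) : 'M[A]_(m, n) :=
  map_mx (fun x => x * a) X.

(** Indices start at 0: [partial 0] maps u^m v^n to i m u^m v^n and [partial 1]
    maps it to i n u^m v^n. *)
Definition partial (i : 'I_2) (f : A) : A :=
  \sum_(k <- msupp f)
    << 'i * (if i == 0 then u_exp k else v_exp k)%:~R * f@_k *g k >>.

Definition diff (a : A) : 'rV[A]_2 := \row_i partial i a.

Lemma partialE i (f : A) k :
  (partial i f)@_k = 'i * (if i == 0 then u_exp k else v_exp k)%:~R * f@_k.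
Proof.
rewrite [f in RHS]monalgE /partial !raddf_sum mulr_sumr.
apply: eq_bigr => l _ /=.
by rewrite !mcoeffU; have [->|_] := eqVneq l k; rewrite ?mulr0.
Qed.

Lemma partialU i (a : C) k :
  partial i (<< a *g k >> : A) =
  ('i * (if i == 0 then u_exp k else v_exp k)%:~R) *: << a *g k >>.
Proof.
apply/malgP => l; rewrite partialE mcoeffZ !mcoeffU.
by have [->|_] := eqVneq k l; rewrite ?mulr0.
Qed.

Lemma partialD i : {morph partial i : f g / f + g}.
Proof.
by move=> f g; apply/malgP => k; rewrite mcoeffD !partialE mcoeffD mulrDr.
Qed.

Lemma partial0 i : partial i 0 = 0.
Proof. by apply/malgP => k; rewrite partialE mcoeff0 mulr0. Qed.

Lemma partial_sum i (I : Type) (s : seq I) (F : I -> A) :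
  partial i (\sum_(j <- s) F j) = \sum_(j <- s) partial i (F j).
Proof. exact: (big_morph _ (partialD i) (partial0 i)). Qed.

Lemma partialM i (f g : A) :
  partial i (f * g) = partial i f * g + f * partial i g.
Proof.
have eq2 (F : A -> A -> A) :
    (forall f1 f2 g, F (f1 + f2) g = F f1 g + F f2 g) -> (forall g, F 0 g = 0) ->
    (forall f g1 g2, F f (g1 + g2) = F f g1 + F f g2) -> (forall f, F f 0 = 0) ->
    F f g = \sum_(k <- msupp f) \sum_(l <- msupp g)
      F << f@_k *g k >> << g@_l *g l >>.
  move=> Fl Fl0 Fr Fr0; rewrite {1}[f]monalgE.
  rewrite (big_morph (F ^~ g) (fun f1 f2 => Fl f1 f2 g) (Fl0 g)).
  apply: eq_bigr => k _; rewrite {1}[g]monalgE.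
  exact: (big_morph (F << f@_k *g k >>) (Fr _) (Fr0 _)).
rewrite (eq2 (fun f g => partial i (f * g))); first last.
- by move=> h; rewrite mulr0 partial0.
- by move=> h1 h2 h3; rewrite mulrDr partialD.
- by move=> h; rewrite mul0r partial0.
- by move=> h1 h2 h3; rewrite mulrDl partialD.
rewrite [RHS](eq2 (fun f g => partial i f * g + f * partial i g)); first last.
- by move=> h; rewrite partial0 !mulr0 addr0.
- by move=> h1 h2 h3; rewrite partialD !mulrDr addrACA.
- by move=> h; rewrite partial0 !mul0r addr0.
- by move=> h1 h2 h3; rewrite partialD !mulrDl addrACA.
apply: eq_bigr => k _; apply: eq_bigr => l _.
rewrite !partialU -scalerAl -scalerAr -scalerDl !nct_mulE !nct_mulUU partialU /=.
by congr (_ *: _); rewrite -mulrDr -intrD; case: (i == 0).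
Qed.

Lemma diffM (a b : A) : diff (a * b) = ract (diff a) b + a *: diff b.
Proof. by apply/rowP => i; rewrite !mxE partialM. Qed.

(** The defining relations of Omega^1, and s^1 = -i u^-1 du, s^2 = -i v^-1 dv. *)
Lemma calculus_relations (u := nct_u q) (v := nct_v q) :
  [/\ ract (diff u) u = u *: diff u,
      ract (diff v) v = v *: diff v,
      ract (diff v) u = (phase_val q)%:A *: (u *: diff v) &
      ract (diff u) v = ((phase_val q)^-1)%:A *: (v *: diff u)].
Proof.
split; apply/rowP => i; rewrite !mxE !partialU /= ?scaler_nat.
- by rewrite -scalerAl -scalerAr.
- by rewrite -scalerAl -scalerAr.
- by rewrite -scalerAl -scalerAr nct_vu mulr_algl !scalerA mulrC.
- rewrite -scalerAl -scalerAr -/u -/v nct_vu mulr_algl !scalerA mulrAC.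
  by rewrite mulVf ?phase_neq0 // mul1r.
Qed.

Lemma diff_basis :
  delta_mx 0 0 = (- 'i)%:A *: (nct_star (nct_u q) *: diff (nct_u q)) /\
  delta_mx 0 1 = (- 'i)%:A *: (nct_star (nct_v q) *: diff (nct_v q)).
Proof.
have [uu _] := nct_u_unitary q; have [vv _] := nct_v_unitary q.
split; apply/rowP => i; rewrite !mxE !partialU /= -scalerAr.
  rewrite uu mulr_algl scalerA.
  case: i => [[|[|//]] ?] /=; rewrite ?mulr0 ?scale0r //.
  by rewrite mulr1 mulNr -expr2 sqrCi opprK scale1r.
rewrite vv mulr_algl scalerA.
case: i => [[|[|//]] ?] /=; rewrite ?mulr0 ?scale0r //.
by rewrite mulr1 mulNr -expr2 sqrCi opprK scale1r.
Qed.

End Calculus.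

Section Spinors.
Context (C : numClosedFieldType) (q : phase C).
Local Notation A := (nctorus q).

(** The spinor [psi_alpha e^alpha] is the row vector of its components. A matrix
    [X] stands for [X i b s^i (x) e^b] in Omega^1 (x)_A S, and in
    S (x)_A Omega^1 for [X a i e^a (x) s^i]. As all bases are central, both
    balanced tensor products of elements are given by [tens]. *)
Definition tens (x y : 'rV[A]_2) : 'M[A]_2 := x^T *m y.

Definition bimodule_map (sigma : 'M[A]_2 -> 'M[A]_2) : Prop :=
  [/\ forall X Y, sigma (X + Y) = sigma X + sigma Y,
      forall (a : A) X, sigma (a *: X) = a *: sigma X &
      forall X (a : A), sigma (ract X a) = ract (sigma X) a].

Definition bimodule_connection (nabla : 'rV[A]_2 -> 'M[A]_2) : Prop :=
  [/\ forall psi phi, nabla (psi + phi) = nabla psi + nabla phi,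
      forall (a : A) psi, nabla (a *: psi) = a *: nabla psi + tens (diff a) psi &
      exists2 sigma, bimodule_map sigma &
        forall psi (a : A),
          nabla (ract psi a) = ract (nabla psi) a + sigma (tens psi (diff a))].

(** [coef nabla i] is the matrix S_i of nabla e^alpha = S^alpha_{i beta}
    s^i (x) e^beta. Its entries lie in A; for a bimodule connection they are
    scalars when q is not a root of unity, i.e. theta / 2 pi is irrational. *)
Definition coef (nabla : 'rV[A]_2 -> 'M[A]_2) (i : 'I_2) : 'M[A]_2 :=
  \matrix_(alpha, beta) nabla (delta_mx 0 alpha) i beta.

Definition const_mxA m n (M : 'M[C]_(m, n)) : 'M[A]_(m, n) :=
  map_mx (fun c => c%:A) M.

Definition cscale m n (c : C) (X : 'M[A]_(m, n)) : 'M[A]_(m, n) :=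
  map_mx (fun x => c *: x) X.

Definition star_mx m n (X : 'M[A]_(m, n)) : 'M[A]_(m, n) :=
  map_mx (@nct_star C q) X.

Definition conj_mx m n (M : 'M[C]_(m, n)) : 'M[C]_(m, n) :=
  map_mx (fun c => c^*) M.

(** The local tensorial conditions on the data (C, J, nabla) with signs eps,
    eps', without covariance of the Clifford action. On the scalar entries of
    [coef nabla i], [star_mx] is entrywise complex conjugation. *)
Record geometric_realisation (Cl : 'I_2 -> 'M[C]_2) (J : 'M[C]_2) (eps eps' : C)
    (nabla : 'rV[A]_2 -> 'M[A]_2) : Prop := GeometricRealisation {
  gr_connection : bimodule_connection nabla ;
  gr_clifford : forall i j,
    Cl i *m Cl j + Cl j *m Cl i = (2 * (i == j)%:R)%:M ;
  gr_J_square : conj_mx J *m J = eps%:M ;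
  gr_J_clifford : forall i, conj_mx (Cl i) *m J = eps' *: (J *m Cl i) ;
  gr_reality : forall i,
    star_mx (coef nabla i) *m const_mxA J = const_mxA J *m coef nabla i }.

Definition gamma_compatible (gamma : 'M[C]_2) (nabla : 'rV[A]_2 -> 'M[A]_2) :=
  forall i, coef nabla i *m const_mxA gamma = const_mxA gamma *m coef nabla i.

Definition partial_mx (i : 'I_2) (psi : 'rV[A]_2) : 'rV[A]_2 :=
  map_mx (partial i) psi.

Definition dirac (Cl : 'I_2 -> 'M[C]_2) (nabla : 'rV[A]_2 -> 'M[A]_2)
    (psi : 'rV[A]_2) : 'rV[A]_2 :=
  \sum_i (partial_mx i psi + psi *m coef nabla i) *m const_mxA (Cl i).

(** J (psi_alpha e^alpha) = psi_alpha^* J^alpha_beta e^beta. *)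
Definition charge_conj (J : 'M[C]_2) (psi : 'rV[A]_2) : 'rV[A]_2 :=
  star_mx psi *m const_mxA J.

Definition even_structure (gamma : 'M[C]_2) (psi : 'rV[A]_2) : 'rV[A]_2 :=
  psi *m const_mxA gamma.

Definition integral (f : A) : C := f@_(Word 0 0).

Definition inner (phi psi : 'rV[A]_2) : C :=
  \sum_alpha integral (nct_star (phi 0 alpha) * psi 0 alpha).

Definition antihermitian (T : 'rV[A]_2 -> 'rV[A]_2) : Prop :=
  forall phi psi, inner (T phi) psi = - inner phi (T psi).

Definition hermitian (T : 'rV[A]_2 -> 'rV[A]_2) : Prop :=
  forall phi psi, inner (T phi) psi = inner phi (T psi).

Definition antilinear_isometry (T : 'rV[A]_2 -> 'rV[A]_2) : Prop :=
  [/\ forall phi psi, T (phi + psi) = T phi + T psi,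
      forall c psi, T (cscale c psi) = cscale c^* (T psi) &
      forall phi psi, inner (T phi) (T psi) = (inner phi psi)^*].

Record spectral_triple (Cl : 'I_2 -> 'M[C]_2) (J : 'M[C]_2) (eps eps' : C)
    (nabla : 'rV[A]_2 -> 'M[A]_2) : Prop := SpectralTriple {
  st_realisation : geometric_realisation Cl J eps eps' nabla ;
  st_antihermitian : antihermitian (dirac Cl nabla) ;
  st_isometry : antilinear_isometry (charge_conj J) }.

Record even_spectral_triple (Cl : 'I_2 -> 'M[C]_2) (J gamma : 'M[C]_2)
    (eps eps' : C) (nabla : 'rV[A]_2 -> 'M[A]_2) : Prop := EvenSpectralTriple {
  est_triple : spectral_triple Cl J eps eps' nabla ;
  est_hermitian : hermitian (even_structure gamma) ;
  est_compatible : gamma_compatible gamma nabla }.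

Definition mx22 (a b c d : C) : 'M[C]_2 :=
  \matrix_(i, j) (if i == 0 then (if j == 0 then a else b)
                  else (if j == 0 then c else d)).

Definition sigma1 : 'M[C]_2 := mx22 0 1 1 0.
Definition sigma2 : 'M[C]_2 := mx22 0 (- 'i) 'i 0.
Definition sigma3 : 'M[C]_2 := mx22 1 0 0 (- 1).

Definition pauli (i : 'I_2) : 'M[C]_2 := if i == 0 then sigma1 else sigma2.

Definition dirac_shift (d : 'I_2 -> C) (psi : 'rV[A]_2) : 'rV[A]_2 :=
  \sum_i (partial_mx i psi + cscale (d i) psi) *m const_mxA (pauli i).

Definition dirac_free (psi : 'rV[A]_2) : 'rV[A]_2 :=
  \sum_i partial_mx i psi *m const_mxA (pauli i).

Definition dirac_mass (m : C) (psi : 'rV[A]_2) : 'rV[A]_2 :=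
  dirac_free psi + cscale ('i * m) psi.

Definition dirac_mass3 (m : C) (psi : 'rV[A]_2) : 'rV[A]_2 :=
  dirac_free psi + cscale ('i * m) (psi *m const_mxA sigma3).

End Spinors.

Section RealModuli.
Context (R : realType) (q : phase R[i]).
Local Notation A := (nctorus q).

Definition affine_family n (nabla0 : 'rV[A]_2 -> 'M[A]_2)
    (dir : 'I_n -> 'rV[A]_2 -> 'M[A]_2) (t : 'rV[R]_n) (psi : 'rV[A]_2) :
    'M[A]_2 :=
  nabla0 psi + \sum_k cscale (t 0 k)%:C%C (dir k psi).

(** The maps satisfying [P] form a real [n]-dimensional affine space: a real
    affine map from R^n is a bijection onto them. *)
Definition real_moduli n (P : ('rV[A]_2 -> 'M[A]_2) -> Prop) : Prop :=
  exists nabla0 dir,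
    (forall t : 'rV[R]_n, P (affine_family nabla0 dir t)) /\
    (forall nabla, P nabla ->
      exists! t : 'rV[R]_n, nabla =1 affine_family nabla0 dir t).

Definition triples_parametrised_by (Cl : 'I_2 -> 'M[R[i]]_2) (J : 'M[R[i]]_2)
    (eps eps' : R[i]) (Dm : R -> 'rV[A]_2 -> 'rV[A]_2) : Prop :=
  (forall m : R, exists2 nabla, spectral_triple Cl J eps eps' nabla &
    dirac Cl nabla =1 Dm m) /\
  (forall nabla, geometric_realisation Cl J eps eps' nabla ->
    (spectral_triple Cl J eps eps' nabla <->
     exists! m : R, dirac Cl nabla =1 Dm m)).

End RealModuli.

Lemma expi_norm (R : realType) (theta : R) :
  `|(cos theta +i* sin theta)%C| = 1.
Proof. by rewrite normc_def /= cos2Dsin2 sqrtr1. Qed.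

Definition expi (R : realType) (theta : R) : phase R[i] :=
  Phase (expi_norm theta).

(* Main.v *)
From HB Require Import structures.
Require Import Defs.
From mathcomp Require Import all_boot all_order all_algebra.
From mathcomp Require Import complex.
From mathcomp Require Import reals trigo.
From mathcomp Require Import boolp finmap monalg ring lra.

(** Three facts carry the proof.

    A bimodule connection has constant coefficients. If [w] is one of the
    generators u, v, then [w e^alpha = e^alpha w], and expanding the connection
    on both sides by the two Leibniz rules shows that the commutator of [w] with
    a coefficient [x] is [w c] for some [c] commuting with [w]. The monomials
    are eigenvectors of conjugation by [w], with eigenvalue 1 only on the powers
    of [w], since q is not a root of unity; comparing Fourier coefficients for
    both generators leaves the constant term of [x] only ([commutator_coef0],
    [coef_scalar]). So the connections are the [const_connection S], for two
    arbitrary complex matrices [S_i].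

    The reality condition is diagonal in Pauli coordinates. Write
    [S_i = a + b sigma1 + c sigma2 + d sigma3]. For both choices of J the
    condition says that a is real, d is imaginary, and b, c equal eps
    times their conjugates: they are real for eps = 1 and imaginary for eps = -1
    ([charge_realP]). These are four real parameters for each i, whence the
    dimension 8; commuting with sigma3 means b = c = 0, whence the dimension 4
    ([pauli_comb_gamma]).

    The Dirac operator of [const_connection S] is the free one plus right
    multiplication by [M = S_0 sigma1 + S_1 sigma2] ([dirac_const_connection]).
    The free one is antihermitian, because the derivations are and the Pauli
    matrices are hermitian, so antihermiticity is the matrix equation [M^dagger = - M]
    ([dirac_pert_antihermitian]). In Pauli coordinates
    [M = e0 + d0 sigma1 + d1 sigma2 + e3 sigma3], where d0, d1 are real, e0 is
    real or imaginary according to eps, and e3 is so according to -eps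
    ([charge_real_sum]). Antihermiticity kills d0 and d1, and the real one of
    e0, e3; the other is the mass term. In the even case e0 = e3 = 0, so that
    only the shifts d0, d1 occur and an even triple has the free operator. *)

Set Implicit Arguments.
Unset Strict Implicit.
Unset Printing Implicit Defensive.

Import Order.TTheory GRing.Theory Num.Theory.
Local Open Scope ring_scope.

Lemma sum_ord2 (V : nmodType) (F : 'I_2 -> V) : \sum_i F i = F 0 + F 1.
Proof. by rewrite big_ord_recl big_ord1; congr (_ + F _); apply: val_inj. Qed.

Lemma ord2P (P : 'I_2 -> Prop) : P 0 -> P 1 -> forall i, P i.
Proof.
move=> P0 P1 [[|[|//]] h].
  by rewrite (_ : Ordinal h = 0) //; apply: val_inj.
by rewrite (_ : Ordinal h = 1) //; apply: val_inj.
Qed.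

(** * Bimodule connections with constant coefficients *)

(** The connection [e^alpha |-> S^alpha_{i beta} s^i (x) e^beta] with constant
    matrices [S_i]. It is locked to keep unification from unfolding it when
    entries of sums of matrices are rewritten. *)
HB.lock Definition const_connection (C : numClosedFieldType) (q : phase C)
    (S : 'I_2 -> 'M[C]_2) (psi : 'rV[nctorus q]_2) : 'M[nctorus q]_2 :=
  \matrix_(i, b) (partial i (psi 0 b) + (psi *m const_mxA q (S i)) 0 b).

Section Torus.
Context (C : numClosedFieldType) (q : phase C).
Local Notation A := (nctorus q).
Local Notation const_connection := (@const_connection C q).

Lemma word_eqE k l : (k == l) = (u_exp k == u_exp l) && (v_exp k == v_exp l).
Proof.
by case: k l => m n [p r]; apply/eqP/andP => [[-> ->] // | [/eqP /= -> /eqP /= ->]].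
Qed.

Lemma mcoeff_wordMl k l (f : A) :
  ((<< 1 *g k >> : A) * f)@_(Word (u_exp k + u_exp l) (v_exp k + v_exp l)) =
  phase_val q ^ (v_exp k * u_exp l) * f@_l.
Proof.
rewrite [f in LHS]monalgE mulr_sumr [f in RHS]monalgE !raddf_sum mulr_sumr /=.
apply: eq_bigr => m _; rewrite nct_mulE nct_mulUU !mcoeffU word_eqE /=.
rewrite !(inj_eq (addrI _)) -word_eqE mul1r mulrC.
by have [->|_] := eqVneq m l; rewrite ?mulr0.
Qed.

Lemma mcoeff_wordMr k l (f : A) :
  (f * (<< 1 *g k >> : A))@_(Word (u_exp k + u_exp l) (v_exp k + v_exp l)) =
  phase_val q ^ (v_exp l * u_exp k) * f@_l.
Proof.
rewrite [f in LHS]monalgE mulr_suml [f in RHS]monalgE !raddf_sum mulr_sumr /=.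
apply: eq_bigr => m _; rewrite nct_mulE nct_mulUU !mcoeffU word_eqE /=.
rewrite !(addrC _ (u_exp k)) !(addrC _ (v_exp k)).
rewrite !(inj_eq (addrI _)) -word_eqE mulr1 mulrC.
by have [->|_] := eqVneq m l; rewrite ?mulr0.
Qed.

(** Conjugation by a monomial is diagonal on monomials. Where its eigenvalue
    differs from 1, [w * c = c * w] forces the coefficient of [c] to vanish, and
    then [w * x - x * w = w * c] forces that of [x] to vanish too. *)
Lemma commutator_coef0 k l (x c : A) (w := << 1 *g k >> : A) :
  phase_val q ^ (v_exp k * u_exp l) != phase_val q ^ (v_exp l * u_exp k) ->
  w * c = c * w -> w * x - x * w = w * c -> x@_l = 0.
Proof.
move=> neq wc wx.
pose kl := Word (u_exp k + u_exp l) (v_exp k + v_exp l).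
have dvd0 (a : C) : phase_val q ^ (v_exp k * u_exp l) * a =
    phase_val q ^ (v_exp l * u_exp k) * a -> a = 0.
  move/eqP; rewrite -subr_eq0 -mulrBl mulf_eq0 subr_eq0 (negPf neq) /=.
  by move/eqP.
have c0 : c@_l = 0.
  by apply: dvd0; rewrite -mcoeff_wordMl -mcoeff_wordMr -/w wc.
have := congr1 (mcoeff kl) wx.
rewrite mcoeffB mcoeff_wordMl mcoeff_wordMr mcoeff_wordMl c0 mulr0.
by move/eqP; rewrite subr_eq0 => /eqP /dvd0.
Qed.

Lemma alg_comm (c : C) (a : A) : a * c%:A = c%:A * a.
Proof. by rewrite -scalerAr mulr1 mulr_algl. Qed.

Lemma partial1 i : partial i (1 : A) = 0.
Proof.
have -> : (1 : A) = << 1 *g Word 0 0 >> by [].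
by rewrite partialU /=; case: ifP; rewrite mulr0 scale0r.
Qed.

Lemma const_connectionE S psi i b :
  const_connection S psi i b = partial i (psi 0 b) + (psi *m const_mxA q (S i)) 0 b.
Proof. by rewrite const_connection.unlock mxE. Qed.

Lemma addmxE m n (X Y : 'M[A]_(m, n)) i j : (X + Y) i j = X i j + Y i j.
Proof. by rewrite mxE. Qed.

Lemma scalemxE m n (a : A) (X : 'M[A]_(m, n)) i j : (a *: X) i j = a * X i j.
Proof. by rewrite mxE. Qed.

Lemma ractE m n (X : 'M[A]_(m, n)) a i j : ract X a i j = X i j * a.
Proof. by rewrite mxE. Qed.

Lemma diffE (a : A) i : diff a 0 i = partial i a.
Proof. by rewrite mxE. Qed.

Lemma tensE (x y : 'rV[A]_2) i j : tens x y i j = x 0 i * y 0 j.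
Proof. by rewrite !mxE big_ord1 !mxE. Qed.

Lemma ract_mul_const (psi : 'rV[A]_2) a (M : 'M[C]_2) :
  ract psi a *m const_mxA q M = ract (psi *m const_mxA q M) a.
Proof.
apply/matrixP => i j; rewrite !mxE mulr_suml; apply: eq_bigr => k _.
by rewrite !mxE -!mulrA alg_comm.
Qed.

(** The generalised braiding is the flip, which is transposition in the chosen
    encoding of the two tensor products. *)
Lemma const_connection_bimodule S : bimodule_connection (const_connection S).
Proof.
split.
- move=> psi phi; apply/matrixP => i b; rewrite addmxE !const_connectionE.
  by rewrite mulmxDl !addmxE partialD addrACA.
- move=> a psi; apply/matrixP => i b; rewrite addmxE scalemxE !const_connectionE.
  by rewrite -scalemxAl !scalemxE partialM tensE diffE mulrDr -addrA addrC.
- exists (fun X => X^T); first split.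
  + by move=> X Y; rewrite raddfD.
  + by move=> a X; apply/matrixP => i b; rewrite !mxE.
  + by move=> X a; apply/matrixP => i b; rewrite !mxE.
  move=> psi a; apply/matrixP => i b; rewrite addmxE ractE !const_connectionE.
  by rewrite ract_mul_const !ractE partialM [_^T _ _]mxE tensE diffE mulrDl addrAC.
Qed.

Lemma coef_const_connection S i : coef (const_connection S) i = const_mxA q (S i).
Proof.
apply/matrixP => a b; rewrite mxE const_connectionE -rowE [row _ _ _ _]mxE mxE.
by case: (_ && _); rewrite /= ?partial1 ?partial0 add0r.
Qed.

Lemma const_mxA_inj m n : injective (@const_mxA C q m n).
Proof.
move=> M N /matrixP MN; apply/matrixP => i j.
have := MN i j; rewrite !mxE => /(congr1 (mcoeff (Word 0 0))).
have one00 : (1 : A)@_(Word 0 0) = 1 by rewrite mcoeffUU.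
by rewrite !mcoeffZ one00 !mulr1.
Qed.

Lemma const_connection_inj S T : const_connection S =1 const_connection T -> S =1 T.
Proof.
move=> ST i; apply: const_mxA_inj; rewrite -!coef_const_connection.
by apply/matrixP => a b; rewrite /coef mxE [RHS]mxE ST.
Qed.

(** Here [w] is a monomial with [dw = i w s^j]. Since [e^alpha] is central, the
    left and right Leibniz rules compute [nabla (w e^alpha)] in two ways; their
    difference expresses the commutator through the value of [sigma] on
    [e^alpha (x) s^j], which commutes with A because [sigma] is a bimodule map
    and its argument is central. *)
Lemma sigma_commutator nabla (k : word) (j : 'I_2) (w := << 1 *g k >> : A) :
  bimodule_connection nabla ->
  (forall i, partial i w = ((i == j)%:R * 'i) *: w) ->
  forall alpha i b, exists c : A, w * c = c * w /\
    w * nabla (delta_mx 0 alpha) i b - nabla (delta_mx 0 alpha) i b * w = w * c.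
Proof.
move=> [nablaD nablaZ [sigma [sD sZ sR] nablaR]] pw alpha i b.
have dw : diff w = ('i *: w) *: delta_mx 0 j.
  apply/rowP => l; rewrite !mxE pw /=.
  by case: (l == j); rewrite /= ?mul1r ?mul0r ?mulr1 ?mulr0 ?scale0r.
have racts a m n (x : 'I_m) (y : 'I_n) :
    ract (delta_mx x y : 'M[A]_(m, n)) a = a *: delta_mx x y.
  apply/matrixP => ? ?; rewrite !mxE.
  by case: (_ && _); rewrite /= ?mul1r ?mul0r ?mulr1 ?mulr0.
set Y := sigma (delta_mx alpha j).
have Yw : ract Y w = w *: Y by rewrite /Y -sR racts sZ.
have tensr (a : A) (x y : 'I_2) : tens (delta_mx 0 x) (a *: delta_mx 0 y) = a *: delta_mx x y.
  apply/matrixP => s t; rewrite !mxE big_ord1 !mxE eqxx /=.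
  by case: (s == x); case: (t == y); rewrite /= ?mul1r ?mul0r ?mulr1 ?mulr0.
have tensl (a : A) (x y : 'I_2) : tens (a *: delta_mx 0 x) (delta_mx 0 y) = a *: delta_mx x y.
  apply/matrixP => s t; rewrite !mxE big_ord1 !mxE eqxx /=.
  by case: (s == x); case: (t == y); rewrite /= ?mul1r ?mul0r ?mulr1 ?mulr0.
have := nablaR (delta_mx 0 alpha) w.
rewrite racts nablaZ dw tensl tensr sZ -/Y => /matrixP /(_ i b); rewrite !mxE => E.
have /matrixP /(_ i b) := Yw; rewrite ractE scalemxE => Yib.
exists ('i *: (Y i b - ((i == j) && (b == alpha))%:R)); split.
  rewrite -scalerAr -scalerAl; congr (_ *: _).
  by rewrite mulrBr mulrBl Yib; congr (_ - _); case: (_ && _); rewrite /= ?mul1r ?mul0r ?mulr1 ?mulr0.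
move/eqP: E; rewrite -subr_eq => /eqP E.
apply/eqP; rewrite subr_eq addrC -scalerAr scalerAl mulrBr addrA -E; apply/eqP.
by rewrite subrK addrK.
Qed.

Lemma partial_u i : partial i (nct_u q) = ((i == 0)%:R * 'i) *: nct_u q.
Proof.
rewrite partialU /=; by case: (i == 0); rewrite ?mulr1 ?mulr0 ?mul1r ?mul0r.
Qed.

Lemma partial_v i : partial i (nct_v q) = ((i == 1)%:R * 'i) *: nct_v q.
Proof.
by rewrite partialU; elim/ord2P: i; rewrite /= ?mulr1 ?mulr0 ?mul1r ?mul0r.
Qed.

Context (hq : forall n : int, n != 0 -> phase_val q ^ n != 1).

(** The commutator with v removes the monomials with a nonzero power of u, and
    the commutator with u those with a nonzero power of v. *)
Lemma coef_scalar nabla i : bimodule_connection nabla ->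
  exists S, coef nabla i = const_mxA q S.
Proof.
move=> hn; exists (\matrix_(a, b) (coef nabla i a b)@_(Word 0 0)).
apply/matrixP => a b; rewrite !mxE.
apply/malgP => l; rewrite mcoeffZ mcoeffU -[X in _ = X * _]/(mcoeff _ _).
have [<-|nl] := eqVneq (Word 0 0) l; first by rewrite mulr1.
rewrite mulr0; move: nl; rewrite eq_sym word_eqE negb_and /= => /orP[ul|vl].
  have [c [wc wx]] := sigma_commutator hn partial_v a i b.
  by apply: (commutator_coef0 _ wc wx); rewrite /= mul1r mulr0 expr0z hq.
have [c [wc wx]] := sigma_commutator hn partial_u a i b.
by apply: (commutator_coef0 _ wc wx); rewrite /= mul0r mulr1 expr0z eq_sym hq.
Qed.

Lemma bimodule_connectionP nabla : bimodule_connection nabla ->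
  exists S, nabla = const_connection S.
Proof.
move=> hn.
have [S0 hS0] := coef_scalar 0 hn; have [S1 hS1] := coef_scalar 1 hn.
pose S (i : 'I_2) := if i == 0 then S0 else S1.
have hS i : coef nabla i = const_mxA q (S i) by elim/ord2P: i.
exists S; apply: funext => psi; case: hn => nablaD nablaZ _.
have -> : psi = psi 0 0 *: delta_mx 0 0 + psi 0 1 *: delta_mx 0 1.
  by rewrite {1}[psi]row_sum_delta sum_ord2.
have [connD connZ _] := const_connection_bimodule S.
rewrite nablaD connD !nablaZ !connZ.
have nE a : nabla (delta_mx 0 a) = const_connection S (delta_mx 0 a).
  apply/matrixP => i b.
  transitivity (coef nabla i a b); first by rewrite mxE.
  by rewrite hS -coef_const_connection mxE.
by rewrite !nE.
Qed.

End Torus.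

(** * The inner product and the Dirac operator *)

Section Inner.
Context (C : numClosedFieldType) (q : phase C).
Local Notation A := (nctorus q).
Local Notation const_connection := (@const_connection C q).
Implicit Types (f g : A) (phi psi : 'rV[A]_2) (M : 'M[C]_2).

(** The monomials are orthonormal for the pairing [int (f^* g)]: the phase in
    [(u^m v^n)^*] cancels the one produced by the multiplication. *)
Lemma pairingU (a : C) k g : integral (nct_star (<< a *g k >> : A) * g) = a^* * g@_k.
Proof.
rewrite nct_starU -[_ * _ ^ _]mulr1 -nct_scaleU -scalerAl /integral mcoeffZ.
have -> : Word 0 0 = Word (u_exp (Word (- u_exp k) (- v_exp k)) + u_exp k)
                          (v_exp (Word (- u_exp k) (- v_exp k)) + v_exp k).
  by rewrite /= !addNr.
rewrite mcoeff_wordMl /= mulrA -(mulrA a^*) -expfzDr ?phase_neq0 //.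
by rewrite mulNr [u_exp k * _]mulrC subrr expr0z mulr1.
Qed.

Lemma pairing_sum (I : Type) (s : seq I) (F : I -> A) g :
  integral (nct_star (\sum_(i <- s) F i) * g) =
  \sum_(i <- s) integral (nct_star (F i) * g).
Proof. by rewrite nct_star_sum mulr_suml /integral raddf_sum. Qed.

(** Monomials are orthonormal eigenvectors of [partial i] with imaginary
    eigenvalues. *)
Lemma pairing_partial i f g :
  integral (nct_star (partial i f) * g) =
  - integral (nct_star f * partial i g).
Proof.
rewrite [f]monalgE partial_sum !pairing_sum -sumrN; apply: eq_bigr => k _.
rewrite partialU nct_scaleU !pairingU partialE !rmorphM /= conjCi.
have -> : ((if i == 0 then u_exp k else v_exp k)%:~R : C)^* =
          (if i == 0 then u_exp k else v_exp k)%:~R by rewrite rmorph_int.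
by ring.
Qed.

Lemma mcoeff_star g k :
  (nct_star g)@_(Word (- u_exp k) (- v_exp k)) =
  (g@_k)^* * phase_val q ^ (u_exp k * v_exp k).
Proof.
rewrite [g in LHS]monalgE nct_star_sum [g in RHS]monalgE !raddf_sum mulr_suml /=.
apply: eq_bigr => l _; rewrite nct_starU !mcoeffU word_eqE /= !eqr_opp -word_eqE.
by have [->|_] := eqVneq l k; rewrite ?mulr1n ?mulr0n ?conjC0 ?mul0r.
Qed.

(** The star operation permutes the orthonormal basis of monomials up to
    phases, and it is antilinear. *)
Lemma pairing_star f g :
  integral (nct_star (nct_star f) * nct_star g) = (integral (nct_star f * g))^*.
Proof.
pose F k : A := << f@_k *g k >>; have -> : f = \sum_(k <- msupp f) F k by exact: monalgE.
rewrite {1}(nct_star_sum (msupp f) F) !pairing_sum raddf_sum; apply: eq_bigr => k _.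
rewrite /= [in RHS]pairingU nct_starU pairingU mcoeff_star !rmorphM /= conjCK conj_phaseX.
by rewrite mulrACA -expfzDr ?phase_neq0 // addNr expr0z mulr1.
Qed.

Lemma star_scale (c : C) f : nct_star (c *: f) = c^* *: nct_star f.
Proof.
rewrite [f]monalgE scaler_sumr !nct_star_sum scaler_sumr; apply: eq_bigr => k _.
by rewrite nct_scaleU !nct_starU nct_scaleU rmorphM mulrA.
Qed.

Lemma nct_star1 : nct_star (1 : A) = 1.
Proof. by rewrite nct_starU /= conjC1 mulr0 expr0z mulr1 oppr0. Qed.

Lemma inner_mulmx phi psi M :
  inner (phi *m const_mxA q M) psi =
  inner phi (psi *m const_mxA q (conj_mx M)^T).
Proof.
rewrite /inner /integral -!raddf_sum; congr (mcoeff _ _).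
transitivity (\sum_a \sum_b (M b a)^* *: (nct_star (phi 0 b) * psi 0 a)).
  apply: eq_bigr => a _; rewrite mxE nct_star_sum mulr_suml; apply: eq_bigr => b _.
  by rewrite mxE -scalerAr mulr1 star_scale -scalerAl.
rewrite exchange_big; apply: eq_bigr => b _; rewrite mxE mulr_sumr.
by apply: eq_bigr => a _; rewrite !mxE -scalerAr mulr1 -scalerAr.
Qed.

Lemma innerDl phi1 phi2 psi : inner (phi1 + phi2) psi = inner phi1 psi + inner phi2 psi.
Proof.
rewrite /inner -big_split; apply: eq_bigr => a _.
by rewrite addmxE nct_starD mulrDl /integral mcoeffD.
Qed.

Lemma innerDr phi psi1 psi2 : inner phi (psi1 + psi2) = inner phi psi1 + inner phi psi2.
Proof.
rewrite /inner -big_split; apply: eq_bigr => a _.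
by rewrite addmxE mulrDr /integral mcoeffD.
Qed.

Lemma inner_partial i phi psi : inner (partial_mx i phi) psi = - inner phi (partial_mx i psi).
Proof.
by rewrite /inner -sumrN; apply: eq_bigr => a _; rewrite !mxE pairing_partial.
Qed.

Lemma inner_star phi psi : inner (star_mx phi) (star_mx psi) = (inner phi psi)^*.
Proof.
by rewrite /inner raddf_sum; apply: eq_bigr => a _; rewrite !mxE pairing_star.
Qed.

(** The pairing of the central basis recovers the entries of a constant matrix,
    which makes the passage from operators to matrices faithful. *)
Lemma inner_delta (a b : 'I_2) M :
  inner (delta_mx 0 a) (delta_mx 0 b *m const_mxA q M) = M b a.
Proof.
rewrite /inner (bigD1 a) //= big1 ?addr0 => [|c ca].
  rewrite -rowE !mxE !eqxx /= nct_star1 mul1r /integral mcoeffZ mcoeffUU mulr1 //.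
by rewrite mxE (negPf ca) andbF nct_star0 mul0r /integral mcoeff0.
Qed.

Lemma partial_mul_const i psi M :
  partial_mx i (psi *m const_mxA q M) = partial_mx i psi *m const_mxA q M.
Proof.
apply/rowP => b; rewrite !mxE partial_sum; apply: eq_bigr => a _.
rewrite !mxE partialM.
have -> : partial i ((M a b)%:A : A) = 0.
  apply/malgP => k; rewrite partialE mcoeffZ mcoeff0.
  have := partial1 q i => /malgP /(_ k); rewrite partialE mcoeff0 mulrCA => ->.
  by rewrite mulr0.
by rewrite mulr0 addr0.
Qed.

Lemma const_mxAM m n p (M : 'M[C]_(m, n)) (N : 'M[C]_(n, p)) :
  const_mxA q (M *m N) = const_mxA q M *m const_mxA q N.
Proof. exact: (map_mxM (in_alg A)). Qed.

Lemma const_mxAD m n (M N : 'M[C]_(m, n)) :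
  const_mxA q (M + N) = const_mxA q M + const_mxA q N.
Proof. exact: (map_mxD (in_alg A)). Qed.

Lemma const_mxA0 m n : const_mxA q (0 : 'M[C]_(m, n)) = 0.
Proof. exact: (map_mx0 (in_alg A)). Qed.

Lemma star_const m n (M : 'M[C]_(m, n)) : star_mx (const_mxA q M) = const_mxA q (conj_mx M).
Proof.
apply/matrixP => i j; rewrite !mxE star_scale; congr (_ *: _).
exact: nct_star1.
Qed.

Lemma const_mxA_scalar (c : C) (psi : 'rV[A]_2) M :
  psi *m const_mxA q (c *: M) = cscale c (psi *m const_mxA q M).
Proof.
apply/rowP => b; rewrite !mxE scaler_sumr; apply: eq_bigr => a _.
by rewrite !mxE -scalerA scalerAr.
Qed.

Lemma const_mxA1 n : const_mxA q (1%:M : 'M[C]_n) = 1%:M.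
Proof. exact: (map_mx1 (in_alg A)). Qed.

Definition dirac_pert M psi : 'rV[A]_2 := dirac_free psi + psi *m const_mxA q M.

Lemma dirac_const_connection S :
  dirac (pauli C) (const_connection S) =1 dirac_pert (\sum_i S i *m pauli C i) :> ('rV[A]_2 -> _).
Proof.
move=> psi; rewrite /dirac /dirac_pert /dirac_free !sum_ord2 !coef_const_connection !mulmxDl.
by rewrite const_mxAD !const_mxAM mulmxDr !mulmxA addrACA.
Qed.

Lemma dirac_shiftE (d : 'I_2 -> C) :
  dirac_shift d =1 dirac_pert (\sum_i d i *: pauli C i) :> ('rV[A]_2 -> _).
Proof.
move=> psi; rewrite /dirac_shift /dirac_pert /dirac_free !sum_ord2 !mulmxDl.
rewrite const_mxAD mulmxDr addrACA !const_mxA_scalar.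
have sc c M : cscale c psi *m const_mxA q M = cscale c (psi *m const_mxA q M).
  apply/rowP => b; rewrite !mxE scaler_sumr; apply: eq_bigr => a _.
  by rewrite !mxE -scalerAl.
by rewrite !sc.
Qed.

Lemma dirac_massE (m : C) :
  dirac_mass m =1 dirac_pert (('i * m) *: 1%:M) :> ('rV[A]_2 -> _).
Proof. by move=> psi; rewrite /dirac_pert const_mxA_scalar const_mxA1 mulmx1. Qed.

Lemma dirac_mass3E (m : C) :
  dirac_mass3 m =1 dirac_pert (('i * m) *: sigma3 C) :> ('rV[A]_2 -> _).
Proof. by move=> psi; rewrite /dirac_pert const_mxA_scalar. Qed.

Lemma dirac_freeE : dirac_free (q := q) =1 dirac_pert 0.
Proof. by move=> psi; rewrite /dirac_pert const_mxA0 mulmx0 addr0. Qed.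

Lemma dirac_pert_inj M N : dirac_pert M =1 dirac_pert N -> M = N.
Proof.
move=> MN; apply: (@const_mxA_inj C q); apply/row_matrixP => a.
by have := MN (delta_mx 0 a) => /addrI; rewrite -!rowE.
Qed.

Lemma pauli_hermitian i : (conj_mx (pauli C i))^T = pauli C i.
Proof.
apply/matrixP => a b; elim/ord2P: i; elim/ord2P: a; elim/ord2P: b.
all: by rewrite /pauli !mxE /= ?conjC0 ?conjC1 ?rmorphN /= ?conjCi ?opprK.
Qed.

Lemma dirac_free_antihermitian : antihermitian (dirac_free (q := q)).
Proof.
move=> phi psi; rewrite /dirac_free !sum_ord2 innerDl innerDr opprD.
by congr (_ + _); rewrite inner_mulmx pauli_hermitian inner_partial partial_mul_const.
Qed.

(** The free part cancels, so the defect of antihermiticity is the pairing with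
    [M^dagger + M], and the pairing is nondegenerate on constants. *)
Lemma dirac_pert_antihermitian M :
  antihermitian (dirac_pert M) <-> (conj_mx M)^T = - M.
Proof.
have H phi psi : inner (dirac_pert M phi) psi + inner phi (dirac_pert M psi) =
    inner phi (psi *m const_mxA q ((conj_mx M)^T + M)).
  rewrite innerDl innerDr dirac_free_antihermitian addrACA addNr add0r.
  by rewrite inner_mulmx -innerDr const_mxAD mulmxDr.
split=> [aM|MN phi psi].
  apply/eqP; rewrite -addr_eq0; apply/eqP/matrixP => b a; rewrite [RHS]mxE.
  by rewrite -inner_delta -H aM addNr.
apply/eqP; rewrite -addr_eq0 H MN addNr const_mxA0 mulmx0 /inner big1 // => a _.
by rewrite mxE mulr0 /integral mcoeff0.
Qed.

Lemma charge_conj_isometry (J : 'M[C]_2) :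
  J *m (conj_mx J)^T = 1%:M -> antilinear_isometry (charge_conj (q := q) J).
Proof.
move=> JJ; split.
- move=> phi psi; rewrite /charge_conj -mulmxDl; congr (_ *m _).
  by apply/rowP => b; rewrite !mxE nct_starD.
- move=> c psi; rewrite /charge_conj.
  apply/rowP => b; rewrite !mxE scaler_sumr; apply: eq_bigr => a _.
  by rewrite !mxE star_scale -scalerAl.
- move=> phi psi.
  by rewrite /charge_conj inner_mulmx -mulmxA -const_mxAM JJ const_mxA1 mulmx1 inner_star.
Qed.

Lemma even_structure_hermitian : Defs.hermitian (even_structure (q := q) (sigma3 C)).
Proof.
move=> phi psi; rewrite /even_structure inner_mulmx; congr (inner _ (_ *m const_mxA q _)).
apply/matrixP => a b; elim/ord2P: a; elim/ord2P: b.
all: by rewrite !mxE /= ?conjC0 ?conjC1 ?conjCN1.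
Qed.

End Inner.

(** * Pauli coordinates and the reality condition *)

Section Pauli.
Context (C : numClosedFieldType).
Implicit Types (a b c d eps lambda : C) (M N J : 'M[C]_2).

Lemma mx22P M N :
  M 0 0 = N 0 0 -> M 0 1 = N 0 1 -> M 1 0 = N 1 0 -> M 1 1 = N 1 1 -> M = N.
Proof.
move=> E00 E01 E10 E11; apply/matrixP => i j.
by elim/ord2P: i; elim/ord2P: j.
Qed.

Lemma mx22_mul a b c d a' b' c' d' :
  mx22 a b c d *m mx22 a' b' c' d' =
  mx22 (a * a' + b * c') (a * b' + b * d') (c * a' + d * c') (c * b' + d * d').
Proof. by apply: mx22P; rewrite !mxE sum_ord2 !mxE. Qed.

Lemma mx22_scale e a b c d : e *: mx22 a b c d = mx22 (e * a) (e * b) (e * c) (e * d).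
Proof. by apply: mx22P; rewrite !mxE. Qed.

Lemma mx22_conj a b c d : conj_mx (mx22 a b c d) = mx22 a^* b^* c^* d^*.
Proof. by apply: mx22P; rewrite !mxE. Qed.

Lemma mx22_tr a b c d : (mx22 a b c d)^T = mx22 a c b d.
Proof. by apply: mx22P; rewrite !mxE. Qed.

Lemma mx22_scalar a : a%:M = mx22 a 0 0 a.
Proof. by apply: mx22P; rewrite !mxE. Qed.

Lemma mx22_add a b c d a' b' c' d' :
  mx22 a b c d + mx22 a' b' c' d' = mx22 (a + a') (b + b') (c + c') (d + d').
Proof. by apply: mx22P; rewrite !mxE. Qed.

Definition mx22E := (mx22_mul, mx22_scale, mx22_conj, mx22_tr, mx22_scalar, mx22_add).

Lemma conjD a b : (a + b)^* = a^* + b^*. Proof. exact: rmorphD. Qed.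
Lemma conjN a : (- a)^* = - a^*. Proof. exact: rmorphN. Qed.
Lemma conjM a b : (a * b)^* = a^* * b^*. Proof. exact: rmorphM. Qed.

Definition conjE := (conjD, conjN, conjM, conjC0, conjC1, conjCi C).

Let i2 : 'i ^+ 2 = - 1 :> C := sqrCi C.

Definition pauli_comb a b c d : 'M[C]_2 :=
  a%:M + b *: sigma1 C + c *: sigma2 C + d *: sigma3 C.

Lemma pauli_combE a b c d :
  pauli_comb a b c d = mx22 (a + d) (b - 'i * c) (b + 'i * c) (a - d).
Proof.
apply: mx22P; rewrite !mxE /= ?mulr0n ?mulr1n.
all: ring.
Qed.

Lemma pauli_comb0 : pauli_comb 0 0 0 0 = 0 :> 'M[C]_2.
Proof. by rewrite /pauli_comb !scale0r raddf0 !addr0. Qed.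

Lemma scale_sigma3 m : m *: sigma3 C = pauli_comb 0 0 0 m.
Proof. by rewrite /pauli_comb -scalemx1 !scale0r !add0r. Qed.

Lemma scale_identity m : m *: 1%:M = pauli_comb m 0 0 0 :> 'M[C]_2.
Proof. by rewrite /pauli_comb !scale0r scalemx1 !addr0. Qed.

Lemma pauli_comb_inj a b c d a' b' c' d' :
  pauli_comb a b c d = pauli_comb a' b' c' d' -> [/\ a = a', b = b', c = c' & d = d'].
Proof.
have aE x y z t : x = (pauli_comb x y z t 0 0 + pauli_comb x y z t 1 1) / 2.
  by rewrite pauli_combE !mxE /=; field.
have bE x y z t : y = (pauli_comb x y z t 0 1 + pauli_comb x y z t 1 0) / 2.
  by rewrite pauli_combE !mxE /=; field.
have cE x y z t : z = 'i * (pauli_comb x y z t 0 1 - pauli_comb x y z t 1 0) / 2.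
  rewrite pauli_combE !mxE /=; transitivity (- 'i ^+ 2 * z); last by field.
  by rewrite i2 opprK mul1r.
have dE x y z t : t = (pauli_comb x y z t 0 0 - pauli_comb x y z t 1 1) / 2.
  by rewrite pauli_combE !mxE /=; field.
move=> E; split.
- by rewrite (aE a b c d) E -aE.
- by rewrite (bE a b c d) E -bE.
- by rewrite (cE a b c d) E -cE.
- by rewrite (dE a b c d) E -dE.
Qed.

Lemma pauli_comb_surj M : exists a b c d, M = pauli_comb a b c d.
Proof.
exists ((M 0 0 + M 1 1) / 2), ((M 0 1 + M 1 0) / 2).
exists ('i * (M 0 1 - M 1 0) / 2), ((M 0 0 - M 1 1) / 2).
by rewrite pauli_combE; apply: mx22P; rewrite !mxE /=; field: i2.
Qed.

Lemma pauli_comb_adj a b c d :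
  (conj_mx (pauli_comb a b c d))^T = pauli_comb a^* b^* c^* d^*.
Proof.
by rewrite !pauli_combE !mx22E !conjE; congr mx22; ring.
Qed.

Lemma pauli_combN a b c d : - pauli_comb a b c d = pauli_comb (- a) (- b) (- c) (- d).
Proof. by rewrite /pauli_comb !opprD !scaleNr raddfN. Qed.

Lemma pauli_comb_mul a b c d a' b' c' d' :
  pauli_comb a b c d *m sigma1 C + pauli_comb a' b' c' d' *m sigma2 C =
  pauli_comb (b + c') (a - 'i * d') ('i * d + a') ('i * (b' - c)).
Proof. by rewrite !pauli_combE /sigma1 /sigma2 !mx22E; congr mx22; ring: i2. Qed.

Lemma pauli_sum_comb S a b c d a' b' c' d' :
  S 0 = pauli_comb a b c d -> S 1 = pauli_comb a' b' c' d' ->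
  \sum_i S i *m pauli C i =
    pauli_comb (b + c') (a - 'i * d') ('i * d + a') ('i * (b' - c)).
Proof. by move=> S0 S1; rewrite sum_ord2 S0 S1 pauli_comb_mul. Qed.

Lemma pauli_comb_sigma3 a b c d :
  pauli_comb a b c d *m sigma3 C = sigma3 C *m pauli_comb a (- b) (- c) d.
Proof. by rewrite !pauli_combE /sigma3 !mx22E; congr mx22; ring. Qed.

(** Conjugation by sigma3 changes the signs of the sigma1 and sigma2
    coordinates. *)
Lemma pauli_comb_gamma a b c d :
  pauli_comb a b c d *m sigma3 C = sigma3 C *m pauli_comb a b c d <-> b = 0 /\ c = 0.
Proof.
rewrite pauli_comb_sigma3; split=> [|[-> ->]]; last by rewrite !oppr0.
move/(congr1 (mulmx (sigma3 C))); rewrite !mulmxA.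
have -> : sigma3 C *m sigma3 C = 1%:M by rewrite /sigma3 !mx22E; congr mx22; ring.
rewrite !mul1mx => /pauli_comb_inj[_ /eqP + /eqP + _].
by rewrite !eqNr => /eqP -> /eqP ->.
Qed.

Lemma pauli_clifford i j :
  pauli C i *m pauli C j + pauli C j *m pauli C i = (2 * (i == j)%:R)%:M.
Proof.
by elim/ord2P: i; elim/ord2P: j; rewrite /pauli /= /sigma1 /sigma2 !mx22E;
  congr mx22; ring: i2.
Qed.

(** As the Pauli matrices are hermitian, taking the adjoint conjugates the
    coordinates; the equation then asks each coordinate to be imaginary, which
    the assumed conjugation rules turn into these conditions. *)
Lemma pauli_comb_antihermitian eps e0 d0 d1 e3 :
  d0^* = d0 -> d1^* = d1 -> e0^* = eps * e0 -> e3^* = - eps * e3 ->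
  (conj_mx (pauli_comb e0 d0 d1 e3))^T = - pauli_comb e0 d0 d1 e3 <->
  [/\ d0 = 0, d1 = 0, eps * e0 = - e0 & eps * e3 = e3].
Proof.
move=> r0 r1 re0 re3; rewrite pauli_comb_adj r0 r1 re0 re3 pauli_combN.
split=> [/pauli_comb_inj[E0 /eqP D0 /eqP D1 E3]|[-> -> -> E3]].
  split=> //; first by apply/eqP; rewrite -eqNr eq_sym.
    by apply/eqP; rewrite -eqNr eq_sym.
  by apply: oppr_inj; rewrite -mulNr.
by rewrite oppr0 mulNr E3.
Qed.

Definition real_structure eps eps' lambda J :=
  (eps = 1 /\ eps' = 1 /\ J = lambda *: sigma1 C) \/
  (eps = - 1 /\ eps' = - 1 /\ J = lambda *: sigma2 C).

Section RealStructure.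
Context eps eps' lambda J (lambda1 : `|lambda| = 1).
Context (hJ : real_structure eps eps' lambda J).

Let conj_lambda : lambda * lambda^* = 1.
Proof. by rewrite -normCK lambda1 expr1n. Qed.

Lemma real_structure_unitary : J *m (conj_mx J)^T = 1%:M.
Proof.
case: hJ => -[_ [_ ->]]; rewrite /sigma1 /sigma2 !mx22E.
  by rewrite !conjE; congr mx22; ring: conj_lambda.
by rewrite !conjE; congr mx22; ring: conj_lambda i2.
Qed.

Lemma real_structure_square : conj_mx J *m J = eps%:M.
Proof.
case: hJ => -[-> [_ ->]]; rewrite /sigma1 /sigma2 !mx22E.
  by rewrite !conjE; congr mx22; ring: conj_lambda.
by rewrite !conjE; congr mx22; ring: conj_lambda i2.
Qed.

Lemma real_structure_clifford i :
  conj_mx (pauli C i) *m J = eps' *: (J *m pauli C i).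
Proof.
case: hJ => -[_ [-> ->]]; elim/ord2P: i; rewrite /pauli /= /sigma1 /sigma2 !mx22E.
all: by rewrite !conjE; congr mx22; ring.
Qed.

(** Entrywise conjugation changes the sign of sigma2 only, and moving the result
    through J changes the signs of the two Pauli matrices that anticommute
    with J. For sigma1 and for sigma2 alike, sigma3 ends up with the sign -1
    and the other two with the sign eps. *)
Lemma real_structure_comb a b c d :
  conj_mx (pauli_comb a b c d) *m J =
  J *m pauli_comb a^* (eps * b^*) (eps * c^*) (- d^*).
Proof.
rewrite !pauli_combE; case: hJ => -[-> [_ ->]]; rewrite /sigma1 /sigma2 !mx22E.
all: by rewrite !conjE; congr mx22; ring.
Qed.

(** The matrices that satisfy the reality condition, in Pauli coordinates. *)
Definition charge_real M := exists a b c d,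
  [/\ M = pauli_comb a b c d, a^* = a /\ d^* = - d & b^* = eps * b /\ c^* = eps * c].

Lemma eps_sqr : eps * eps = 1.
Proof. by case: hJ => -[-> _]; ring. Qed.

Lemma charge_realP M : conj_mx M *m J = J *m M <-> charge_real M.
Proof.
have JJ : (conj_mx J)^T *m J = 1%:M by apply: mulmx1C; exact: real_structure_unitary.
split=> [|[a [b [c [d [-> [ra rd] [rb rc]]]]]]]; last first.
  by rewrite real_structure_comb ra rb rc rd !mulrA eps_sqr !mul1r opprK.
have [a [b [c [d ->]]]] := pauli_comb_surj M; rewrite real_structure_comb.
move/(congr1 (mulmx (conj_mx J)^T)); rewrite !mulmxA JJ !mul1mx.
move/pauli_comb_inj => -[ra rb rc rd]; exists a, b, c, d; split=> //.
  by split=> //; rewrite -[in RHS]rd opprK.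
by split; rewrite -[in RHS](rb, rc) mulrA eps_sqr mul1r.
Qed.

(** Multiplying by sigma1 and sigma2 and adding turns the coordinates of type
    eps of the [S_i] into e0 directly and into e3 after a factor of the
    imaginary unit, which accounts for the opposite sign; the other coordinates
    all contribute to the real d0 and d1. *)
Lemma charge_real_sum S : (forall i, charge_real (S i)) ->
  exists e0 d0 d1 e3,
  [/\ \sum_i S i *m pauli C i = pauli_comb e0 d0 d1 e3,
      d0^* = d0 /\ d1^* = d1 & e0^* = eps * e0 /\ e3^* = - eps * e3].
Proof.
move=> hS; have [a [b [c [d [S0 [ra rd] [rb rc]]]]]] := hS 0.
have [a' [b' [c' [d' [S1 [ra' rd'] [rb' rc']]]]]] := hS 1.
rewrite (pauli_sum_comb S0 S1); do 4 eexists; split; first reflexivity.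
all: by rewrite !conjE ?ra ?ra' ?rb ?rb' ?rc ?rc' ?rd ?rd'; split; ring.
Qed.

End RealStructure.

Lemma mass3_antihermitian m : m^* = m ->
  (conj_mx (('i * m) *: sigma3 C))^T = - (('i * m) *: sigma3 C).
Proof.
by move=> rm; rewrite scale_sigma3 pauli_comb_adj pauli_combN !conjE rm !oppr0 mulNr.
Qed.

Lemma mass_antihermitian m : m^* = m ->
  (conj_mx (('i * m) *: 1%:M : 'M[C]_2))^T = - (('i * m) *: 1%:M).
Proof.
by move=> rm; rewrite scale_identity pauli_comb_adj pauli_combN !conjE rm !oppr0 mulNr.
Qed.

(** Many connections have the same Dirac operator, as only the combination
    [S_0 sigma1 + S_1 sigma2] enters. The one chosen has [S_0 = 0] and
    [S_1 = m sigma1], and uses [sigma1 sigma2 = i sigma3]. *)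
Lemma mass3_realised m : m^* = m ->
  exists2 S, forall i, charge_real 1 (S i) &
             \sum_i S i *m pauli C i = ('i * m) *: sigma3 C.
Proof.
move=> rm; exists (fun i => pauli_comb 0 (if i == 0 then 0 else m) 0 0) => [i|].
  exists 0, (if i == 0 then 0 else m), 0, 0.
  by case: (i == 0); rewrite !mul1r conjC0 oppr0 ?rm.
rewrite (pauli_sum_comb (a := 0) (b := 0) (c := 0) (d := 0)
  (a' := 0) (b' := m) (c' := 0) (d' := 0)) //.
by rewrite scale_sigma3 !(mulr0, oppr0, add0r, addr0).
Qed.

(** Here [S_0 = i m sigma1] and [S_1 = 0]. *)
Lemma mass_realised m : m^* = m ->
  exists2 S, forall i, charge_real (-1) (S i) &
             \sum_i S i *m pauli C i = ('i * m) *: 1%:M.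
Proof.
move=> rm; exists (fun i => pauli_comb 0 (if i == 0 then 'i * m else 0) 0 0) => [i|].
  exists 0, (if i == 0 then 'i * m else 0), 0, 0.
  by case: (i == 0); rewrite !mulN1r !conjE !oppr0 ?rm ?mulNr.
rewrite (pauli_sum_comb (a := 0) (b := 'i * m) (c := 0) (d := 0)
  (a' := 0) (b' := 0) (c' := 0) (d' := 0)) //.
by rewrite scale_identity !(mulr0, oppr0, add0r, addr0).
Qed.

End Pauli.

(** * Geometric realisations and spectral triples *)

Section Realisations.
Context (C : numClosedFieldType) (q : phase C).
Context (hq : forall n : int, n != 0 -> phase_val q ^ n != 1).
Local Notation A := (nctorus q).
Local Notation const_connection := (@const_connection C q).
Context (eps eps' lambda : C) (J : 'M[C]_2) (lambda1 : `|lambda| = 1).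
Context (hJ : real_structure eps eps' lambda J).

(** The matrices of [charge_real] that commute with sigma3. The sign eps has
    gone with the sigma1 and sigma2 coordinates. *)
Definition even_charge_real (M : 'M[C]_2) := exists a d,
  [/\ M = pauli_comb a 0 0 d, a^* = a & d^* = - d].

Lemma geometric_realisationP nabla :
  geometric_realisation (q := q) (pauli C) J eps eps' nabla <->
  exists2 S, nabla = const_connection S & forall i, charge_real eps (S i).
Proof.
split=> [[/(bimodule_connectionP hq)[S ->] _ _ _ hr]|[S -> hS]].
  exists S => // i; apply/(charge_realP lambda1 hJ)/(@const_mxA_inj C q).
  by rewrite !const_mxAM -star_const -coef_const_connection.
split.
- exact: const_connection_bimodule.
- exact: pauli_clifford.
- exact: (real_structure_square lambda1 hJ).
- exact: (real_structure_clifford hJ).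
- move=> i; rewrite coef_const_connection star_const -!const_mxAM.
  by congr (const_mxA q _); apply/(charge_realP lambda1 hJ).
Qed.

Lemma even_realisationP nabla :
  geometric_realisation (q := q) (pauli C) J eps eps' nabla /\
    gamma_compatible (q := q) (sigma3 C) nabla <->
  exists2 S, nabla = const_connection S & forall i, even_charge_real (S i).
Proof.
split=> [[/geometric_realisationP[S -> hS] hg]|[S -> hS]].
  exists S => // i; have := hg i; rewrite coef_const_connection -!const_mxAM.
  move/const_mxA_inj; have [a [b [c [d [-> [ra rd] _]]]]] := hS i.
  by case/pauli_comb_gamma => -> ->; exists a, d.
split.
  apply/geometric_realisationP; exists S => // i; have [a [d [-> ra rd]]] := hS i.
  by exists a, 0, 0, d; rewrite conjC0 mulr0.
move=> i; rewrite coef_const_connection -!const_mxAM; congr (const_mxA q _).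
by have [a [d [-> _ _]]] := hS i; apply/pauli_comb_gamma.
Qed.

Lemma spectral_tripleP S (M := \sum_i S i *m pauli C i) :
  (forall i, charge_real eps (S i)) ->
  spectral_triple (q := q) (pauli C) J eps eps' (const_connection S) <-> (conj_mx M)^T = - M.
Proof.
move=> hS; rewrite -(dirac_pert_antihermitian q) -(funext (@dirac_const_connection C q S)).
split=> [[]//|aD]; split=> //; first by apply/geometric_realisationP; exists S.
exact/charge_conj_isometry/(real_structure_unitary lambda1 hJ).
Qed.

Lemma even_spectral_tripleP nabla :
  geometric_realisation (q := q) (pauli C) J eps eps' nabla /\
    gamma_compatible (q := q) (sigma3 C) nabla ->
  even_spectral_triple (q := q) (pauli C) J (sigma3 C) eps eps' nabla <->
  dirac (pauli C) nabla =1 dirac_free (q := q).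
Proof.
move=> he; have [hg hgam] := he; case/even_realisationP: he => S nS hS.
have hcS i : charge_real eps (S i).
  have [a [d [-> ra rd]]] := hS i; exists a, 0, 0, d; by rewrite conjC0 mulr0.
have [a [d [S0 ra rd]]] := hS 0; have [a' [d' [S1 ra' rd']]] := hS 1.
have ME := pauli_sum_comb S0 S1; rewrite addr0 subrr mulr0 in ME.
have E : even_spectral_triple (q := q) (pauli C) J (sigma3 C) eps eps' nabla <->
         spectral_triple (q := q) (pauli C) J eps eps' nabla.
  split=> [[]//|ht]; split=> //; exact: even_structure_hermitian.
rewrite E nS spectral_tripleP // (funext (@dirac_const_connection C q S)) (funext (@dirac_freeE C q)) ME.
have r0 : (a - 'i * d')^* = a - 'i * d' by rewrite !conjE ra rd'; ring.
have r1 : ('i * d + a')^* = 'i * d + a' by rewrite !conjE ra' rd; ring.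
rewrite (@pauli_comb_antihermitian _ eps) ?conjC0 ?mulr0 ?oppr0 //.
split=> [[-> -> _ _] psi|/dirac_pert_inj]; rewrite -?pauli_comb0 //.
by move/pauli_comb_inj => -[_ -> -> _].
Qed.

End Realisations.

(** * Irrational angles *)

Lemma sin_int_pi (R : realType) (k : int) : sin (k%:~R * pi) = 0 :> R.
Proof.
have nat_pi n : sin (n%:R * pi) = 0 :> R.
  rewrite mulr_natl; elim: n => [|n IH]; first by rewrite mulr0n sin0.
  by rewrite mulrSr sinDpi IH oppr0.
by case: k => n; rewrite ?NegzE ?mulrNz ?mulNr ?sinN nat_pi ?oppr0.
Qed.

(** Translating by a multiple of pi brings the argument into the interval
    from 0 to pi, in whose interior the sine is positive. *)
Lemma sin_eq0 (R : realType) (y : R) : sin y = 0 -> exists k : int, y = k%:~R * pi.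
Proof.
move=> sy; exists (Num.floor (y / pi)); set k := Num.floor _.
have /andP[kle klt] : k%:~R <= y / pi < (k + 1)%:~R by rewrite Num.Theory.floor_itv.
have pi0 : 0 < pi :> R := pi_gt0 R.
apply/eqP; rewrite -subr_eq0; set r := y - _.
have r0 : 0 <= r by rewrite subr_ge0 -ler_pdivlMr.
have rpi : r < pi.
  by move: klt; rewrite ltr_pdivrMr // intrD mulrDl mul1r /r ltrBlDl.
have sr : sin r = 0 by rewrite sinB sy sin_int_pi mul0r mulr0 subrr.
apply: contraTT r0 => rn0; rewrite -ltNge ltNge; apply/negP => r0.
have : 0 < sin r by apply: sin_gt0_pi; rewrite rpi lt0r rn0 r0.
by rewrite sr ltxx.
Qed.

Lemma cos_eq1 (R : realType) (x : R) : cos x = 1 -> exists k : int, x = k%:~R * (2 * pi).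
Proof.
move=> cx; have [] := @sin_eq0 R (x / 2).
  have E2 : cos x = cos (x / 2) ^+ 2 *+ 2 - 1.
    by rewrite -cos_mulr2n; congr cos; field.
  have E1 := cos2Dsin2 (x / 2).
  apply/eqP; rewrite -sqrf_eq0; apply/eqP; lra.
move=> k hk; exists k; rewrite mulrCA -hk mulrC divfK // pnatr_eq0 //.
Qed.

Lemma expi_exp (R : realType) (theta : R) n :
  (cos theta +i* sin theta)%C ^+ n =
  (cos (n%:R * theta) +i* sin (n%:R * theta))%C.
Proof.
elim: n => [|n IH]; first by rewrite expr0 mul0r cos0 sin0.
rewrite exprSr IH -natr1 mulrDl mul1r cosD sinD.
by apply/eqP; rewrite eq_complex /= addrC eqxx [_ * cos _ + _]addrC mulrC eqxx.
Qed.

Lemma expi_not_root_of_unity (R : realType) (theta : R) :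
  irrational (theta / (2 * pi)) ->
  forall n : int, n != 0 -> phase_val (expi theta) ^ n != 1.
Proof.
move=> irr n n0; apply/eqP => qn.
have [N N0 qN] : exists2 N, N%:R != 0 :> R & phase_val (expi theta) ^+ N = 1.
  case: n n0 qn => N N0 qN; first by exists N; rewrite // pnatr_eq0.
  exists N.+1; first by rewrite pnatr_eq0.
  by apply: invr_inj; rewrite invr1.
move: qN; rewrite [phase_val _]/= expi_exp => -[/cos_eq1[k hk] _].
apply: irr; exists (k%:~R / N%:R) => //.
rewrite fmorph_div /= ratr_int ratr_nat.
have pi0 : pi != 0 :> R by rewrite gt_eqF ?pi_gt0.
apply: (mulfI N0); rewrite [in RHS]mulrA hk mulfK ?mulf_neq0 ?pnatr_eq0 //.
by rewrite mulrC divfK.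
Qed.

(** * Real dimensions *)

Section Moduli.
Context (R : realType) (q : phase R[i]).
Local Notation A := (nctorus q).
Local Notation const_connection := (@const_connection _ q).

Lemma cscaleE m n (c : R[i]) (X : 'M[A]_(m, n)) i j : cscale c X i j = c *: X i j.
Proof. by rewrite mxE. Qed.

Definition real_span n (B : 'I_n -> 'M[R[i]]_2) (t : 'rV[R]_n) : 'M[R[i]]_2 :=
  \sum_k (t 0 k)%:C%C *: B k.

(** If the admissible values of each matrix [S_i] form the real span of [n]
    independent matrices, then [n] coordinates for [S_0] followed by [n] for
    [S_1] parametrise the connections: [const_connection S] is affine in [S],
    with the flat connection as base point. *)
Lemma real_moduli_of_span n (B : 'I_n -> 'M[R[i]]_2) (V : 'M[R[i]]_2 -> Prop)
    (P : ('rV[A]_2 -> 'M[A]_2) -> Prop) :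
  injective (real_span B) -> (forall M, V M <-> exists t, M = real_span B t) ->
  (forall nabla, P nabla <-> exists2 S, nabla = const_connection S & forall i, V (S i)) ->
  real_moduli (q := q) (n + n) P.
Proof.
move=> B_inj VP PP.
(* The direction of index k moves [S_0] if k < n, and [S_1] otherwise. *)
pose E (k : 'I_(n + n)) (i : 'I_2) : 'M[R[i]]_2 :=
  match split k with
  | inl l => if i == 0 then B l else 0
  | inr l => if i == 0 then 0 else B l
  end.
pose dir k (psi : 'rV[A]_2) : 'M[A]_2 :=
  \matrix_(i, b) (psi *m const_mxA q (E k i)) 0 b.
pose S (t : 'rV[R]_(n + n)) (i : 'I_2) :=
  real_span B (if i == 0 then lsubmx t else rsubmx t).
have SE t i : S t i = \sum_k (t 0 k)%:C%C *: E k i.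
  rewrite big_split_ord /= /S /real_span.
  have EL (l : 'I_n) : E (lshift n l) i = if i == 0 then B l else 0.
    by rewrite /E (unsplitK (inl l)).
  have ER (l : 'I_n) : E (rshift n l) i = if i == 0 then 0 else B l.
    by rewrite /E (unsplitK (inr l)).
  under [X in _ = X + _]eq_bigr do rewrite EL.
  under [X in _ = _ + X]eq_bigr do rewrite ER.
  case: (i == 0).
    rewrite [X in _ = _ + X]big1 ?addr0 => [|l _]; last by rewrite scaler0.
    by apply: eq_bigr => l _; rewrite mxE.
  rewrite [X in _ = X + _]big1 ?add0r => [|l _]; last by rewrite scaler0.
  by apply: eq_bigr => l _; rewrite mxE.
have affE t : affine_family (const_connection (fun=> 0)) dir t = const_connection (S t).
  apply: funext => psi; apply/matrixP => i b.
  have E0 : const_connection (fun=> 0) psi i b = partial i (psi 0 b).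
    by rewrite const_connectionE const_mxA0 mulmx0 [X in _ + X]mxE addr0.
  rewrite /affine_family addmxE E0 const_connectionE.
  congr (_ + _); rewrite SE.
  have -> : const_mxA q (\sum_k (t 0 k)%:C%C *: E k i) =
            \sum_k const_mxA q ((t 0 k)%:C%C *: E k i).
    exact: (big_morph _ (@const_mxAD _ q 2 2) (const_mxA0 q 2 2)).
  rewrite mulmx_sumr !summxE; apply: eq_bigr => k _.
  by rewrite const_mxA_scalar [RHS]cscaleE [LHS]cscaleE /dir; congr (_ *: _); rewrite mxE.
exists (const_connection (fun=> 0)), dir; split=> [t|nabla /PP[T -> VT]].
  by rewrite affE; apply/PP; exists (S t) => // i; apply/VP; eexists; reflexivity.
have [t0 ht0] := (VP _).1 (VT 0); have [t1 ht1] := (VP _).1 (VT 1).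
have ST : S (row_mx t0 t1) =1 T by apply: ord2P; rewrite /S /= ?row_mxKl ?row_mxKr.
exists (row_mx t0 t1); split=> [|t].
  by rewrite affE (funext ST).
rewrite affE => /const_connection_inj hT; apply/esym.
rewrite -[t]hsubmxK; congr row_mx; apply: B_inj.
  by rewrite -ht0 hT.
by rewrite -ht1 hT.
Qed.

Lemma conj_real (x : R) : (x%:C%C)^* = x%:C%C :> R[i].
Proof. by apply/CrealP; rewrite complex_real. Qed.

(** Any nonzero [u] with the same conjugation rule as [z] serves as a real unit
    for it, since [z / u] is fixed by conjugation. *)
Lemma real_multiple (e u z : R[i]) :
  e != 0 -> u != 0 -> u^* = e * u ->
  z^* = e * z <-> exists x : R, z = u * x%:C%C.
Proof.
move=> e0 u0 ue; split=> [ze|[x ->]]; last by rewrite conjM ue conj_real mulrA.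
have zu_real : z / u \is Num.real.
  by apply/CrealP; rewrite fmorph_div /= ze ue -mulf_div divff // mul1r.
by exists (complex.Re (z / u)); rewrite (RRe_real zu_real) mulrC divfK.
Qed.

Lemma real_number (z : R[i]) : z^* = z <-> exists x : R, z = x%:C%C.
Proof.
by split=> [/CrealP/complex_realP //|[x ->]]; rewrite conj_real.
Qed.

Lemma imaginary_number (z : R[i]) : z^* = - z <-> exists x : R, z = 'i * x%:C%C.
Proof.
rewrite -mulN1r; apply: real_multiple; rewrite ?oppr_eq0 ?oner_eq0 ?neq0Ci //.
by rewrite conjCi mulN1r.
Qed.

(** With [zeta] of the conjugation type [eps] (1 for eps = 1, the imaginary unit
    for eps = -1), the four matrices are a real basis of those that satisfy the
    reality condition; the first two span the ones that commute with sigma3. *)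
Definition pauli_basis (zeta : R[i]) n (k : 'I_n) : 'M[R[i]]_2 :=
  nth 0 [:: 1%:M; 'i *: sigma3 _; zeta *: sigma1 _; zeta *: sigma2 _] k.

Lemma sum_ord4 (V : nmodType) (F : 'I_4 -> V) : \sum_i F i = F 0 + F 1 + F 2 + F 3.
Proof.
rewrite !big_ord_recl big_ord0 addr0 !addrA.
by congr (F _ + F _ + F _ + F _); apply: val_inj.
Qed.

Lemma real_span4 zeta t : real_span (@pauli_basis zeta 4) t =
  pauli_comb (t 0 0)%:C%C (zeta * (t 0 2)%:C%C) (zeta * (t 0 3)%:C%C) ('i * (t 0 1)%:C%C).
Proof.
rewrite /real_span sum_ord4 /pauli_comb -scalemx1 ![_ * (_%:C)%C]mulrC -!scalerA.
by rewrite -[LHS]addrA -[LHS]addrA [X in _ + X]addrC !addrA.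
Qed.

Lemma real_span2 zeta t : real_span (@pauli_basis zeta 2) t =
  pauli_comb (t 0 0)%:C%C 0 0 ('i * (t 0 1)%:C%C).
Proof.
rewrite /real_span sum_ord2 /pauli_comb !scale0r !addr0 -scalemx1.
by rewrite ['i * _]mulrC -scalerA.
Qed.

End Moduli.

(** * The moduli on the torus *)

Section TorusModuli.
Context (R : realType) (q : phase R[i]).
Context (hq : forall n : int, n != 0 -> phase_val q ^ n != 1).
Local Notation A := (nctorus q).
Local Notation const_connection := (@const_connection _ q).
Local Notation C := (R[i]).
Context (eps eps' lambda : R[i]) (J : 'M[R[i]]_2) (lambda1 : `|lambda| = 1).
Context (hJ : real_structure eps eps' lambda J).

Lemma eps_neq0 : eps != 0.
Proof. by case: hJ => -[-> _]; rewrite ?oppr_eq0 oner_eq0. Qed.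

Lemma charge_real_span zeta M : zeta != 0 -> zeta^* = eps * zeta ->
  charge_real eps M <-> exists t, M = real_span (@pauli_basis R zeta 4) t.
Proof.
move=> z0 ze; split=> [[a [b [c [d]]]] [-> [/real_number[x ->] /imaginary_number[y ->]]] []|[t ->]].
  case/(real_multiple b eps_neq0 z0 ze) => p ->.
  case/(real_multiple c eps_neq0 z0 ze) => r ->.
  by exists (\row_k nth 0 [:: x; y; p; r] k); rewrite real_span4 !mxE.
rewrite real_span4; do 4 eexists; split; first reflexivity.
  by rewrite !conjE !conj_real mulNr.
by rewrite !conjE !conj_real ze !mulrA.
Qed.

Lemma real_span4_inj zeta : zeta != 0 -> injective (real_span (@pauli_basis R zeta 4)).
Proof.
move=> z0 s t; rewrite !real_span4 => /pauli_comb_inj[/complexI E0].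
move=> /(mulfI z0)/complexI E2 /(mulfI z0)/complexI E3 /(mulfI (neq0Ci _))/complexI E1.
apply/rowP => k; have : k \in [:: 0; 1; 2; 3] by case: k => [[|[|[|[|//]]]] ?].
by rewrite !inE => /or4P[] /eqP ->.
Qed.

Lemma even_charge_real_span M :
  even_charge_real M <-> exists t, M = real_span (@pauli_basis R 0 2) t.
Proof.
split=> [[a [d [-> /real_number[x ->] /imaginary_number[y ->]]]]|[t ->]].
  by exists (\row_k nth 0 [:: x; y] k); rewrite real_span2 !mxE.
rewrite real_span2; do 2 eexists; split; first reflexivity.
  by rewrite conj_real.
by rewrite !conjE !conj_real mulNr.
Qed.

Lemma real_span2_inj : injective (real_span (@pauli_basis R 0 2)).
Proof.
move=> s t; rewrite !real_span2 => /pauli_comb_inj[/complexI E0 _ _].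
by move=> /(mulfI (neq0Ci _))/complexI E1; apply/rowP; apply: ord2P.
Qed.

Lemma realisation_moduli :
  real_moduli (q := q) 8 (geometric_realisation (q := q) (pauli R[i]) J eps eps').
Proof.
have [zeta z0 ze] : exists2 zeta : R[i], zeta != 0 & zeta^* = eps * zeta.
  case: hJ => -[-> _]; first by exists 1; rewrite ?oner_eq0 ?conjC1 ?mulr1.
  by exists 'i; rewrite ?neq0Ci // conjCi mulN1r.
apply: (@real_moduli_of_span R q 4 _ (charge_real eps)).
- exact: (real_span4_inj z0).
- by move=> M; exact: charge_real_span.
- exact: (geometric_realisationP hq lambda1 hJ).
Qed.

Lemma even_realisation_moduli :
  real_moduli (q := q) 4 (fun nabla =>
    geometric_realisation (q := q) (pauli R[i]) J eps eps' nabla /\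
    gamma_compatible (q := q) (sigma3 R[i]) nabla).
Proof.
apply: (@real_moduli_of_span R q 2 _ (@even_charge_real R[i])).
- exact: real_span2_inj.
- exact: even_charge_real_span.
- exact: (even_realisationP hq lambda1 hJ).
Qed.

Lemma pauli_sum (d : 'I_2 -> R[i]) :
  \sum_i d i *: pauli R[i] i = pauli_comb 0 (d 0) (d 1) 0.
Proof. by rewrite sum_ord2 /pauli_comb -scalemx1 !scale0r addr0 add0r. Qed.

(** A scalar [S_i = d_i] realises the shift by [d_i]; conversely the imaginary
    sigma3 coordinates of the [S_i] are absorbed into real shifts because
    [sigma3 sigma1 = i sigma2] and [sigma3 sigma2 = - i sigma1]. *)
Lemma even_dirac_shift (D : 'rV[A]_2 -> 'rV[A]_2) :
  (exists2 nabla,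
     geometric_realisation (q := q) (pauli R[i]) J eps eps' nabla /\
     gamma_compatible (q := q) (sigma3 R[i]) nabla &
     D =1 dirac (q := q) (pauli R[i]) nabla) <->
  (exists d : 'I_2 -> R, D =1 dirac_shift (q := q) (fun i => (d i)%:C%C)).
Proof.
split=> [[nabla /(even_realisationP hq lambda1 hJ)[S -> hS] DE]|[d DE]].
  have [a [d [S0 ra rd]]] := hS 0; have [a' [d' [S1 ra' rd']]] := hS 1.
  have ME := pauli_sum_comb S0 S1; rewrite addr0 subrr mulr0 in ME.
  have /real_number[x xE] : (a - 'i * d')^* = a - 'i * d' by rewrite !conjE ra rd'; ring.
  have /real_number[y yE] : ('i * d + a')^* = 'i * d + a' by rewrite !conjE ra' rd; ring.
  exists (fun i => if i == 0 then x else y) => psi.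
  by rewrite DE dirac_const_connection dirac_shiftE pauli_sum ME xE yE.
pose S i := pauli_comb (d i)%:C%C 0 0 0.
exists (const_connection S).
  apply/(even_realisationP hq lambda1 hJ); exists S => // i.
  by exists (d i)%:C%C, 0; rewrite conj_real conjC0 oppr0.
move=> psi; rewrite DE dirac_const_connection dirac_shiftE pauli_sum.
by rewrite (pauli_sum_comb (erefl (S 0)) (erefl (S 1))) !(mulr0, oppr0, add0r, addr0).
Qed.

(** A spectral triple is a realisation with antihermitian mass matrix, so a
    one-parameter family [Dm] is the full answer as soon as its mass matrices
    [N m] are distinct, realised, and exactly the antihermitian ones. *)
Lemma triples_parametrised (N : R -> 'M[R[i]]_2) (Dm : R -> 'rV[A]_2 -> 'rV[A]_2) :
  injective N -> (forall m, Dm m =1 dirac_pert (N m)) ->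
  (forall m, (conj_mx (N m))^T = - N m) ->
  (forall m, exists2 S, forall i, charge_real eps (S i) & \sum_i S i *m pauli C i = N m) ->
  (forall S, (forall i, charge_real eps (S i)) ->
    let M := \sum_i S i *m pauli C i in
    (conj_mx M)^T = - M -> exists m, M = N m) ->
  triples_parametrised_by (q := q) (pauli R[i]) J eps eps' Dm.
Proof.
move=> N_inj DN aN NS SN; split=> [m|nabla /(geometric_realisationP hq lambda1 hJ)[S -> hS]].
  have [S hS SE] := NS m; exists (const_connection S).
    by apply/(spectral_tripleP hq lambda1 hJ hS); rewrite SE.
  by move=> psi; rewrite DN dirac_const_connection SE.
rewrite (spectral_tripleP hq lambda1 hJ hS); split=> [/(SN S hS)[m ME]|[m [DE _]]].
  exists m; split=> [psi|m' DE]; first by rewrite dirac_const_connection ME DN.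
  apply: N_inj; rewrite -ME; apply: (@dirac_pert_inj C q) => psi.
  by rewrite -dirac_const_connection DE DN.
rewrite (_ : \sum_i _ = N m) //; apply: (@dirac_pert_inj C q) => psi.
by rewrite -dirac_const_connection DE DN.
Qed.

Lemma mass3_family : eps = 1 ->
  triples_parametrised_by (q := q) (pauli R[i]) J eps eps'
    (fun m : R => dirac_mass3 (q := q) m%:C%C).
Proof.
move=> eps1; apply: (@triples_parametrised (fun m => ('i * m%:C%C) *: sigma3 C)).
- move=> m n; rewrite !scale_sigma3 => /pauli_comb_inj[_ _ _].
  by move=> /(mulfI (neq0Ci _))/complexI.
- by move=> m psi; rewrite dirac_mass3E.
- by move=> m; apply: mass3_antihermitian; exact: conj_real.
- by move=> m; rewrite eps1; apply: mass3_realised; exact: conj_real.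
- move=> S hS M; have [e0 [d0 [d1 [e3 [ME [r0 r1] [re0 re3]]]]]] := charge_real_sum hS.
  rewrite /M ME; case/(pauli_comb_antihermitian r0 r1 re0 re3) => -> -> E0 _.
  move: E0 re3; rewrite eps1 mul1r mulN1r => /eqP; rewrite eq_sym eqNr => /eqP ->.
  by case/imaginary_number => m ->; exists m; rewrite scale_sigma3.
Qed.

Lemma mass_family : eps = - 1 ->
  triples_parametrised_by (q := q) (pauli R[i]) J eps eps'
    (fun m : R => dirac_mass (q := q) m%:C%C).
Proof.
move=> eps1; apply: (@triples_parametrised (fun m => ('i * m%:C%C) *: 1%:M)).
- move=> m n; rewrite !scale_identity => /pauli_comb_inj[+ _ _ _].
  by move=> /(mulfI (neq0Ci _))/complexI.
- by move=> m psi; rewrite dirac_massE.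
- by move=> m; apply: mass_antihermitian; exact: conj_real.
- by move=> m; rewrite eps1; apply: mass_realised; exact: conj_real.
- move=> S hS M; have [e0 [d0 [d1 [e3 [ME [r0 r1] [re0 re3]]]]]] := charge_real_sum hS.
  rewrite /M ME; case/(pauli_comb_antihermitian r0 r1 re0 re3) => -> -> _ E3.
  move: E3 re0; rewrite eps1 !mulN1r => /eqP; rewrite eqNr => /eqP ->.
  by case/imaginary_number => m ->; exists m; rewrite scale_identity.
Qed.

End TorusModuli.

Theorem proposition3p6 (R : realType) (theta : R)
    (htheta : irrational (theta / (2 * pi)))
    (lambda : R[i]) (hlambda : `|lambda| = 1)
    (eps eps' : R[i]) (J : 'M[R[i]]_2)
    (hJ : (eps = 1 /\ eps' = 1 /\ J = lambda *: sigma1 R[i]) \/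
          (eps = - 1 /\ eps' = - 1 /\ J = lambda *: sigma2 R[i])) :
  let q := expi theta in
  let A := nctorus q in
  let sigma := pauli R[i] in
  let moduli : ('rV[A]_2 -> 'M[A]_2) -> Prop :=
    geometric_realisation (q := q) sigma J eps eps' in
  let even_moduli : ('rV[A]_2 -> 'M[A]_2) -> Prop :=
    fun nabla => moduli nabla /\ gamma_compatible (q := q) (sigma3 R[i]) nabla in
  [/\ real_moduli (q := q) 8 moduli,
      real_moduli (q := q) 4 even_moduli,
      forall D : 'rV[A]_2 -> 'rV[A]_2,
        (exists2 nabla, even_moduli nabla & D =1 dirac (q := q) sigma nabla) <->
        (exists d : 'I_2 -> R, D =1 dirac_shift (q := q) (fun i => (d i)%:C%C)),
      forall nabla, even_moduli nabla ->
        (even_spectral_triple (q := q) sigma J (sigma3 R[i]) eps eps' nabla <->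
         dirac (q := q) sigma nabla =1 dirac_free (q := q)) &
      (eps = 1 -> triples_parametrised_by sigma J eps eps'
         (fun m : R => dirac_mass3 (q := q) m%:C%C)) /\
      (eps = - 1 -> triples_parametrised_by sigma J eps eps'
         (fun m : R => dirac_mass (q := q) m%:C%C))].
Proof.
have hq := expi_not_root_of_unity htheta.
split.
- exact: (@realisation_moduli R (expi theta) hq eps eps' lambda J hlambda hJ).
- exact: (@even_realisation_moduli R (expi theta) hq eps eps' lambda J hlambda hJ).
- exact: (@even_dirac_shift R (expi theta) hq eps eps' lambda J hlambda hJ).
- exact: (@even_spectral_tripleP _ (expi theta) hq eps eps' lambda J hlambda hJ).
- split; first exact: (@mass3_family R (expi theta) hq eps eps' lambda J hlambda hJ).
  exact: (@mass_family R (expi theta) hq eps eps' lambda J hlambda hJ).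
Qed.
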